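(* There is an algorithm that, given a Stable Fixtures instance $I=(A,\succ,c)$ with $n$ agents, computes a generalised stable partition (GSP) of $I$ in $O(n^4)$ time.
   Context: A Stable Fixtures (SF) instance is $I=(A,\succ,c)$ where $A=\{a_1,\dots,a_n\}$ is a finite set of $n$ agents; each agent $a_i$ has a strict linear order $\succ_i$ over $A\setminus\{a_i\}$ (complete preference list), with the convention that every agent ranks itself last ($a_j\succ_i a_i$ for all $j\neq i$); $a\succeq_i b$ means $a\succ_i b$ or $a=b$. Each agent has an integer capacity $c_i$ with $1\le c_i<n$. A cyclic permutation of a nonempty set $A_r\subseteq A$ is a permutation $\Pi_r$ of $A_r$ consisting of a single cycle of length $|A_r|$ (length 1: a fixed point $(a_i)$; length 2: a transposition $(a_i\ a_j)$). Two cyclic permutations are distinct if some element is mapped to different elements by them. A GSP of $I$ is a finite collection $\Pi=\{\Pi_1,\dots,\Pi_k\}$ of cyclic permutations $\Pi_r$ of sets $A_r\subseteq A$, pairwise distinct except that fixed points may be repeated, such that: (F1) for every $r$ and every $a_j\in A_r$, $\Pi_r(a_j)\succeq_j\Pi_r^{-1}(a_j)$; (F2) there are no distinct $a_i,a_j\in A$ with the transposition $(a_i\ a_j)\notin\Pi$ such that $a_j\succ_i\Pi_r^{-1}(a_i)$ and $a_i\succ_j\Pi_s^{-1}(a_j)$ for some $\Pi_r,\Pi_s\in\Pi$ with $a_i\in A_r$, $a_j\in A_s$; (F3) for every $a_i\in A$, the number of indices $r$ with $a_i\in A_r$ equals $c_i$; (F4) for all distinct $a_i,a_j\in A$, $|\{s:\Pi_s(a_i)=a_j\}|+|\{s:\Pi_s(a_j)=a_i\}|\le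 2$. *)

(* Defs.v *)
From HB Require Import structures.
From mathcomp Require Import all_boot all_fingroup.

Set Implicit Arguments.
Unset Strict Implicit.
Unset Printing Implicit Defensive.

(** * Stable Fixtures instances *)

(* The agents are the elements of 'I_n.  [pref i a b] reads "agent i strictly
   prefers a to b".  It is a strict linear order on all agents with i last,
   that is, a strict linear order on the agents other than i together with the
   convention that every agent ranks itself last. *)
Record sf_instance (n : nat) := SFInstance {
  pref : 'I_n -> rel 'I_n;
  cap : 'I_n -> nat;
  pref_irr : forall i, irreflexive (pref i);
  pref_trans : forall i, transitive (pref i);
  pref_total : forall i a b, a != b -> pref i a b || pref i b a;
  pref_self_last : forall i j, j != i -> pref i j i;
  cap_bounds : forall i, 1 <= cap i < n
}.

Definition wpref n (I : sf_instance n) (i a b : 'I_n) : bool :=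
  (a == b) || pref I i a b.

(** * Generalised stable partitions *)

(* A cyclic permutation of the nonempty set [cset], extended by the identity
   outside it.  The carrier is part of the data, so that the fixed points (a)
   and (b) remain different objects. *)
Record cyc_perm (n : nat) := CycPerm {
  cset : {set 'I_n};
  cfun : {perm 'I_n};
  cset_neq0 : cset != set0;
  cfun_on : perm_on cset cfun;
  cfun_cycle : forall a, a \in cset -> porbit cfun a = cset
}.

Definition cinv n (P : cyc_perm n) (a : 'I_n) : 'I_n := (cfun P)^-1%g a.

Definition fixed_point n (P : cyc_perm n) : bool := #|cset P| == 1.

Definition is_transp n (i j : 'I_n) (P : cyc_perm n) : bool :=
  (cset P == [set i; j]) && (cfun P == tperm i j).

Definition cyc_distinct n (P Q : cyc_perm n) : bool :=
  [exists a, cfun P a != cfun Q a].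

(* [Pi] lists the members of the collection, with repetitions; positions in
   [Pi] play the role of the indices r and s. *)
Record is_GSP n (I : sf_instance n) (Pi : seq (cyc_perm n)) : Prop := IsGSP {
  gsp_distinct :
    pairwise (fun P Q => (fixed_point P && fixed_point Q) || cyc_distinct P Q)
             Pi;
  gsp_F1 :
    all (fun P => [forall j in cset P, wpref I j (cfun P j) (cinv P j)]) Pi;
  gsp_F2 : forall i j : 'I_n, i != j -> ~~ has (is_transp i j) Pi ->
    ~ (has (fun P => (i \in cset P) && pref I i j (cinv P i)) Pi /\
       has (fun Q => (j \in cset Q) && pref I j i (cinv Q j)) Pi);
  gsp_F3 : forall i : 'I_n, count (fun P => i \in cset P) Pi = cap I i;
  gsp_F4 : forall i j : 'I_n, i != j ->
    count (fun P => cfun P i == j) Pi + count (fun P => cfun P j == i) Pi <= 2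
}.

(** * A word RAM *)

(* While-programs over a random-access memory holding natural numbers: scalar
   registers [reg x], and memory banks [mem b] indexed by arbitrary computed
   addresses.  Register and bank names are literals, so every program uses a
   fixed finite number of each.  Words have [w] bits: an execution in which
   some expression takes a value >= 2 ^ w is stuck.  Evaluating an expression
   costs one step per node, and every command other than [Seq] adds one more. *)

Inductive binop := OpAdd | OpSub | OpMul | OpLt | OpEq.

Definition binop_sem (o : binop) (x y : nat) : nat :=
  match o with
  | OpAdd => x + y
  | OpSub => x - y
  | OpMul => x * y
  | OpLt => x < y
  | OpEq => x == y
  end.

Inductive expr :=
  | Cst of nat
  | Reg of nat
  | Get of nat & expr
  | Bin of binop & expr & expr.

Inductive cmd :=
  | Skip
  | SetReg of nat & expr
  | SetMem of nat & expr & expr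
  | Seq of cmd & cmd
  | If of expr & cmd & cmd
  | While of expr & cmd.

Record store := Store { reg : nat -> nat; mem : nat -> nat -> nat }.

Definition set_reg (s : store) (x v : nat) : store :=
  Store (fun y => if y == x then v else reg s y) (mem s).

Definition set_mem (s : store) (b i v : nat) : store :=
  Store (reg s)
    (fun b' i' => if (b' == b) && (i' == i) then v else mem s b' i').

Definition word (w v : nat) : option nat := if v < 2 ^ w then Some v else None.

Fixpoint eval (w : nat) (s : store) (e : expr) : option nat :=
  match e with
  | Cst k => word w k
  | Reg x => word w (reg s x)
  | Get b e1 => if eval w s e1 is Some i then word w (mem s b i) else None
  | Bin o e1 e2 =>
      if eval w s e1 is Some x then
        if eval w s e2 is Some y then word w (binop_sem o x y) else None
      else None
  end.

Fixpoint ecost (e : expr) : nat :=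
  match e with
  | Cst _ | Reg _ => 1
  | Get _ e1 => (ecost e1).+1
  | Bin _ e1 e2 => (ecost e1 + ecost e2).+1
  end.

(* [exec w c s t s']: with [w]-bit words, [c] started in [s] halts in [s'] after
   [t] steps. *)
Inductive exec (w : nat) : cmd -> store -> nat -> store -> Prop :=
  | ExecSkip s : exec w Skip s 1 s
  | ExecSetReg x e s v :
      eval w s e = Some v -> exec w (SetReg x e) s (ecost e).+1 (set_reg s x v)
  | ExecSetMem b e1 e2 s i v :
      eval w s e1 = Some i -> eval w s e2 = Some v ->
      exec w (SetMem b e1 e2) s (ecost e1 + ecost e2).+1 (set_mem s b i v)
  | ExecSeq c1 c2 s t1 s1 t2 s2 :
      exec w c1 s t1 s1 -> exec w c2 s1 t2 s2 ->
      exec w (Seq c1 c2) s (t1 + t2) s2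
  | ExecIf e c1 c2 s v t s' :
      eval w s e = Some v -> exec w (if v != 0 then c1 else c2) s t s' ->
      exec w (If e c1 c2) s (ecost e + t).+1 s'
  | ExecWhileEnd e c s :
      eval w s e = Some 0 -> exec w (While e c) s (ecost e).+1 s
  | ExecWhileLoop e c s v t1 s1 t2 s2 :
      eval w s e = Some v -> v != 0 ->
      exec w c s t1 s1 -> exec w (While e c) s1 t2 s2 ->
      exec w (While e c) s (ecost e + t1 + t2).+1 s2.

(** * Input and output conventions *)

Definition pref_list n (I : sf_instance n) (i : 'I_n) : seq 'I_n :=
  sort (wpref I i) (enum (predC1 i)).

(* Register 0 holds n, bank 0 the capacities, and bank 1 the preference lists,
   most preferred agent first, one after the other (n - 1 cells for each agent).
   Everything else is initially 0. *)
Definition input_store n (I : sf_instance n) : store :=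
  let caps := [seq cap I i | i <- enum 'I_n] in
  let prefs := flatten [seq map val (pref_list I i) | i <- enum 'I_n] in
  Store (fun x => if x == 0 then n else 0)
        (fun b k => if b == 0 then nth 0 caps k
                    else if b == 1 then nth 0 prefs k else 0).

Definition cycle_code n (P : cyc_perm n) (x : 'I_n) : seq nat :=
  #|cset P| :: map val (traject (cfun P) x #|cset P|).

(* [out] represents the collection [Pi]: the number of cycles, then, for each
   cycle, its length and its elements in cyclic order from an arbitrary starting
   point. *)
Definition gsp_code n (Pi : seq (cyc_perm n)) (out : seq nat) : Prop :=
  exists xs : seq 'I_n,
    all2 (fun P x => x \in cset P) Pi xs /\
    out = size Pi :: flatten [seq cycle_code Px.1 Px.2 | Px <- zip Pi xs].

(* The output is read off from the first cells of bank 2. *)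
Definition outputs_GSP n (I : sf_instance n) (s : store) : Prop :=
  exists (Pi : seq (cyc_perm n)) (out : seq nat),
    [/\ is_GSP I Pi, gsp_code Pi out & mkseq (mem s 2) (size out) = out].

Definition bigO (f g : nat -> nat) : Prop :=
  exists C N : nat, forall n, N <= n -> f n <= C * g n.

(* Main.v *)
(* The algorithm is of Irving-Scott type.  Every agent j keeps a threshold in
   its preference list, and two agents are entries of each other's list when
   each lies at or above the threshold of the other; each i proposes to its
   first cap i entries.  If the proposals to j other than the one from its
   threshold agent fill j, the threshold moves up.  Once no threshold moves,
   every agent receives as many proposals as it makes.  If moreover some agent
   has more than cap + 1 entries, the map sending x to the worst entry of the
   first agent that x does not propose to is followed into a cycle, and all
   those first agents drop their worst entry; counting proposals shows that
   they remain filled.  Otherwise the reciprocated proposals are transpositions,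
   the missing proposals are fixed points, and the unreciprocated proposals form
   disjoint longer cycles, since every agent makes and receives at most one of
   them.  The sum of the thresholds decreases in each round, so that n^2 rounds
   of cost O(n^2) suffice. *)
Require Import Defs.
From mathcomp Require Import all_boot all_fingroup.
From mathcomp Require Import zify.
(* So that [mem] denotes the memory of a store. *)
Import Defs.

Set Implicit Arguments.
Unset Strict Implicit.
Unset Printing Implicit Defensive.

(** * Programs built from loops of length n *)

(** Why a rotation keeps its agents filled: let [y = sec x] with [x] on the cycle. Dropping its
    worst entry costs [y] one proposal, and [x] replaces it: [x] is the worst entry of some
    [y' = sec x'] to which it proposes, and [y'] drops it, so [y] moves up from position [cap x]
    into the proposals of [x]. This fails only if [x] itself drops [y], that is, if [x] is one of
    the dropping agents and [y] is its worst entry. Then [x] has exactly cap + 1 entries, and this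
    defect propagates backwards along [nxt] to the agent where the walk began. Starting the walk at
    an agent with more than cap + 1 entries excludes it.

    On the machine side an overflow blocks execution, so word length must be controlled as well as
    time. All loops have n iterations, with guards in place of early exits. The time bound then
    depends on the nesting depth only and the bound on values on the syntax only; in return, rounds
    executed after a final table has been reached must be harmless. *)

Inductive prog :=
  | PSkip
  | PSet of nat & expr
  | PPut of nat & expr & expr
  | PSeq of prog & prog
  | PIf of expr & prog & prog
  | PFor of nat & prog.

Fixpoint compile (p : prog) : cmd :=
  match p with
  | PSkip => Skip
  | PSet x e => SetReg x e
  | PPut b e1 e2 => SetMem b e1 e2
  | PSeq p1 p2 => Seq (compile p1) (compile p2)
  | PIf e p1 p2 => If e (compile p1) (compile p2)
  | PFor x p1 =>
      Seq (SetReg x (Cst 0))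
          (While (Bin OpLt (Reg x) (Reg 0))
             (Seq (compile p1) (SetReg x (Bin OpAdd (Reg x) (Cst 1)))))
  end.

Fixpoint ev (s : store) (e : expr) : nat :=
  match e with
  | Cst k => k
  | Reg x => reg s x
  | Get b e1 => mem s b (ev s e1)
  | Bin o e1 e2 => binop_sem o (ev s e1) (ev s e2)
  end.

Fixpoint run (p : prog) (s : store) : store :=
  match p with
  | PSkip => s
  | PSet x e => set_reg s x (ev s e)
  | PPut b e1 e2 => set_mem s b (ev s e1) (ev s e2)
  | PSeq p1 p2 => run p2 (run p1 s)
  | PIf e p1 p2 => if ev s e != 0 then run p1 s else run p2 s
  | PFor x p1 =>
      set_reg (iteri (reg s 0) (fun k s' => run p1 (set_reg s' x k)) s)
              x (reg s 0)
  end.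

Fixpoint wregs (p : prog) : seq nat :=
  match p with
  | PSkip | PPut _ _ _ => [::]
  | PSet x _ => [:: x]
  | PSeq p1 p2 | PIf _ p1 p2 => wregs p1 ++ wregs p2
  | PFor x p1 => x :: wregs p1
  end.

Fixpoint wbanks (p : prog) : seq nat :=
  match p with
  | PSkip | PSet _ _ => [::]
  | PPut b _ _ => [:: b]
  | PSeq p1 p2 | PIf _ p1 p2 => wbanks p1 ++ wbanks p2
  | PFor _ p1 => wbanks p1
  end.

Lemma run_reg p s x : x \notin wregs p -> reg (run p s) x = reg s x.
Proof.
elim: p s => [|y e|b e1 e2|p1 IH1 p2 IH2|e p1 IH1 p2 IH2|y p1 IH1] s //=.
- by rewrite inE => /negbTE->.
- by rewrite mem_cat => /norP[H1 H2]; rewrite IH2 // IH1.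
- by rewrite mem_cat => /norP[H1 H2]; case: ifP => _; [rewrite IH1|rewrite IH2].
- rewrite inE => /norP[/negbTE Hy H1]; rewrite Hy.
  by elim: (reg s 0) => //= k IHk; rewrite IH1 //= Hy.
Qed.

Lemma run_mem p s b i : b \notin wbanks p -> mem (run p s) b i = mem s b i.
Proof.
elim: p s => [|y e|b' e1 e2|p1 IH1 p2 IH2|e p1 IH1 p2 IH2|y p1 IH1] s //=.
- by rewrite inE => /negbTE->.
- by rewrite mem_cat => /norP[H1 H2]; rewrite IH2 // IH1.
- by rewrite mem_cat => /norP[H1 H2]; case: ifP => _; [rewrite IH1|rewrite IH2].
- by move=> H1; elim: (reg s 0) => //= k IHk; rewrite IH1.
Qed.

Lemma run_for_ind (n : nat) (P : nat -> store -> Prop) x p s :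
  reg s 0 = n -> P 0 s ->
  (forall (i : 'I_n) s', P i s' -> P i.+1 (run p (set_reg s' x i))) ->
  exists2 s', P n s' & run (PFor x p) s = set_reg s' x n.
Proof.
move=> /= -> P0 PS.
exists (iteri n (fun k s' => run p (set_reg s' x k)) s) => //.
suff: forall k, k <= n ->
  P k (iteri k (fun k s' => run p (set_reg s' x k)) s) by apply.
elim=> [//|k IHk] lt_kn /=.
exact: (PS (Ordinal lt_kn)) (IHk (ltnW lt_kn)).
Qed.

(* Assigned values must exceed the largest stored value by a constant at most;
   this rules out overflow in polynomial time without any invariant on the
   values computed by a program. *)
Fixpoint slope (e : expr) : nat :=
  match e with
  | Cst _ | Bin OpLt _ _ | Bin OpEq _ _ => 0
  | Reg _ | Get _ _ => 1
  | Bin OpAdd e1 e2 => slope e1 + slope e2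
  | Bin OpSub e1 _ => slope e1
  | Bin OpMul _ _ => 2
  end.

Fixpoint offset (e : expr) : nat :=
  match e with
  | Reg _ | Get _ _ => 0
  | Cst k => k
  | Bin OpAdd e1 e2 => offset e1 + offset e2
  | Bin OpSub e1 _ => offset e1
  | Bin _ _ _ => 1
  end.

(** The body of a loop must preserve register 0, the bound, and its own counter; only then does the
    compiled while loop make exactly n iterations, as [run] assumes. *)
Fixpoint wf (p : prog) : bool :=
  match p with
  | PSkip => true
  | PSet _ e | PPut _ _ e => slope e <= 1
  | PSeq p1 p2 | PIf _ p1 p2 => wf p1 && wf p2
  | PFor x p1 => [&& wf p1, x != 0, 0 \notin wregs p1 & x \notin wregs p1]
  end.

Fixpoint growth (p : prog) (n : nat) : nat :=
  match p with
  | PSkip => 0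
  | PSet _ e | PPut _ _ e => offset e
  | PSeq p1 p2 | PIf _ p1 p2 => growth p1 n + growth p2 n
  | PFor _ p1 => n * growth p1 n
  end.

(* Bounds the values of all subexpressions when stored values are at most M. *)
Fixpoint emax (e : expr) (M : nat) : nat :=
  match e with
  | Cst k => k
  | Reg _ => M
  | Get _ e1 => M + emax e1 M
  | Bin OpMul e1 e2 => emax e1 M + emax e2 M + emax e1 M * emax e2 M
  | Bin _ e1 e2 => (emax e1 M + emax e2 M).+1
  end.

Fixpoint pmax (p : prog) (M : nat) : nat :=
  match p with
  | PSkip => 0
  | PSet _ e => emax e M
  | PPut _ e1 e2 => emax e1 M + emax e2 M
  | PSeq p1 p2 => pmax p1 M + pmax p2 M
  | PIf e p1 p2 => emax e M + pmax p1 M + pmax p2 M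
  | PFor _ p1 => pmax p1 M + (M + M).+1
  end.

Fixpoint cost (p : prog) (n : nat) : nat :=
  match p with
  | PSkip => 1
  | PSet _ e => (ecost e).+1
  | PPut _ e1 e2 => (ecost e1 + ecost e2).+1
  | PSeq p1 p2 => cost p1 n + cost p2 n
  | PIf e p1 p2 => (ecost e + (cost p1 n + cost p2 n)).+1
  | PFor _ p1 => n * (cost p1 n + 8) + 6
  end.

Fixpoint depth (p : prog) : nat :=
  match p with
  | PSkip | PSet _ _ | PPut _ _ _ => 0
  | PSeq p1 p2 | PIf _ p1 p2 => maxn (depth p1) (depth p2)
  | PFor _ p1 => (depth p1).+1
  end.

Definition bounded (M : nat) (s : store) : Prop :=
  (forall x, reg s x <= M) /\ (forall b i, mem s b i <= M).

Lemma bounded_le M1 M2 s : M1 <= M2 -> bounded M1 s -> bounded M2 s.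
Proof.
by move=> le12 [Hr Hm]; split=> *; apply: leq_trans le12; [apply: Hr|apply: Hm].
Qed.

Lemma bounded_set_reg M s x v :
  bounded M s -> v <= M -> bounded M (set_reg s x v).
Proof. by case=> Hr Hm Hv; split=> [y|] //=; case: ifP. Qed.

Lemma bounded_set_mem M s b i v :
  bounded M s -> v <= M -> bounded M (set_mem s b i v).
Proof. by case=> Hr Hm Hv; split=> [|b' i'] //=; case: ifP. Qed.

Lemma ev_slope M s e : bounded M s -> slope e <= 1 ->
  ev s e <= slope e * M + offset e.
Proof.
case=> Hr Hm; elim: e => [k|x|b e1 _|o e1 IH1 e2 IH2] /=.
- by rewrite mul0n.
- by move: (Hr x); lia.
- by move: (Hm b (ev s e1)); lia.
- case: o => /=.
  + by move=> le1; move: (IH1 ltac:(lia)) (IH2 ltac:(lia)); nia.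
  + by move=> le1; move: (IH1 le1); nia.
  + by [].
  + by move=> _; rewrite leq_b1.
  + by move=> _; rewrite leq_b1.
Qed.

Lemma ev_le_emax M s e : bounded M s -> ev s e <= emax e M.
Proof.
case=> Hr Hm; elim: e => [k|x|b e1 _|o e1 IH1 e2 IH2] //=.
- by move: (Hm b (ev s e1)); lia.
- by case: o => /=; nia.
Qed.

Lemma eval_ev w M s e : bounded M s -> emax e M < 2 ^ w ->
  eval w s e = Some (ev s e).
Proof.
move=> bM; elim: e => [k|x|b e1 IH1|o e1 IH1 e2 IH2] /= lt_w.
- by rewrite /word lt_w.
- by rewrite /word (leq_ltn_trans _ lt_w) //; case: bM.
- rewrite IH1 ?(leq_ltn_trans _ lt_w) ?leq_addl // /word.
  by rewrite (leq_ltn_trans _ lt_w) // (leq_trans (bM.2 _ _)) ?leq_addr.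
- have := @ev_le_emax M s (Bin o e1 e2) bM => /= le_o.
  rewrite IH1 ?IH2; first by rewrite /word (leq_ltn_trans le_o lt_w).
  + by apply: leq_ltn_trans lt_w; case: (o); lia.
  + by apply: leq_ltn_trans lt_w; case: (o); lia.
Qed.

Lemma emax_le e : {homo emax e : M1 M2 / M1 <= M2}.
Proof.
move=> M1 M2 le12; elim: e => [k|x|b e1 IH1|o e1 IH1 e2 IH2] //=.
  exact: leq_add.
by case: o; rewrite /= ?ltnS !leq_add ?leq_mul.
Qed.

Lemma pmax_le p : {homo pmax p : M1 M2 / M1 <= M2}.
Proof.
move=> M1 M2 le12.
by elim: p => [|x e|b e1 e2|p1 IH1 p2 IH2|e p1 IH1 p2 IH2|x p1 IH1] //=;
  rewrite ?leq_add ?emax_le // ltnS leq_add.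
Qed.

Theorem exec_compile w n p s M :
    wf p -> reg s 0 = n -> 0 \notin wregs p -> bounded M s ->
    pmax p (M + growth p n) < 2 ^ w ->
  bounded (M + growth p n) (run p s) /\
  exists2 t, exec w (compile p) s t (run p s) & t <= cost p n.
Proof.
elim: p s M => [|x e|b e1 e2|p1 IH1 p2 IH2|e p1 IH1 p2 IH2|x p1 IH1] s M /=.
- by move=> _ _ _ bM _; rewrite addn0; split=> //; exists 1 => //; constructor.
- move=> le_e s0 _ bM ltw; have bM' := bounded_le (leq_addr (offset e) M) bM.
  split; last by exists (ecost e).+1 => //; constructor; apply: eval_ev bM' _.
  apply: bounded_set_reg => //; apply: leq_trans (ev_slope bM le_e) _.
  by rewrite leq_add2r; case: (slope e) le_e => [|[|]] // _; rewrite ?mul1n.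
- move=> le_e s0 _ bM ltw; have bM' := bounded_le (leq_addr (offset e2) M) bM.
  split.
    apply: bounded_set_mem => //; apply: leq_trans (ev_slope bM le_e) _.
    by rewrite leq_add2r; case: (slope e2) le_e => [|[|]] // _; rewrite ?mul1n.
  exists (ecost e1 + ecost e2).+1 => //; constructor; apply: eval_ev bM' _; lia.
- move=> /andP[wf1 wf2] s0; rewrite mem_cat => /norP[r1 r2] bM ltw.
  have [|bM1 [t1 ex1 let1]] := IH1 _ _ wf1 s0 r1 bM.
    by apply: leq_ltn_trans ltw; apply: leq_trans (leq_addr _ _);
       apply: pmax_le; lia.
  have s10 : reg (run p1 s) 0 = n by rewrite run_reg.
  have [|bM2 [t2 ex2 let2]] := IH2 _ _ wf2 s10 r2 bM1.
    by apply: leq_ltn_trans ltw; rewrite -addnA leq_addl.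
  split; first by rewrite addnA.
  by exists (t1 + t2); [apply: ExecSeq ex1 ex2 | apply: leq_add].
- move=> /andP[wf1 wf2] s0; rewrite mem_cat => /norP[r1 r2] bM ltw.
  have eve : eval w s e = Some (ev s e).
    apply: (eval_ev bM); apply: leq_ltn_trans ltw.
    by rewrite -addnA; apply: leq_trans (leq_addr _ _); apply: emax_le; lia.
  case E: (ev s e != 0).
    have [|bM1 [t1 ex1 let1]] := IH1 _ _ wf1 s0 r1 bM.
      apply: leq_ltn_trans ltw; rewrite -addnA.
      apply: leq_trans (leq_addl _ _); apply: leq_trans (leq_addr _ _).
      by apply: pmax_le; lia.
    split; first by apply: bounded_le bM1; lia.
    exists (ecost e + t1).+1; last by lia.
    by apply: ExecIf eve _; rewrite E.
  have [|bM1 [t1 ex1 let1]] := IH2 _ _ wf2 s0 r2 bM.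
    apply: leq_ltn_trans ltw; rewrite -addnA.
    apply: leq_trans (leq_addl _ _); apply: leq_trans (leq_addl _ _).
    by apply: pmax_le; lia.
  split; first by apply: bounded_le bM1; lia.
  exists (ecost e + t1).+1; last by lia.
  by apply: ExecIf eve _; rewrite E.
- move=> /and4P[wf1 x0 r10 r1x] s0 _ bM; set g := growth p1 n => ltw.
  rewrite s0; set f := fun k s' => run p1 (set_reg s' x k).
  (* The counter never exceeds register 0, which is itself at most [M]; hence the loop overhead
     contributes nothing to [growth]. *)
  have le_nM : n <= M by rewrite -s0; case: bM.
  have ltp k : k < n -> pmax p1 (M + k * g + g) < 2 ^ w.
    move=> lt_kn; apply: leq_ltn_trans ltw; apply: leq_trans (leq_addr _ _).
    by apply: pmax_le; rewrite -addnA leq_add2l -mulSnr leq_mul2r lt_kn orbT.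
  have lt2 : (M + M).+1 < 2 ^ w by apply: leq_ltn_trans ltw; lia.
  have f0 k : reg (iteri k f s) 0 = n.
    by elim: k => //= k IHk; rewrite run_reg //= eq_sym (negbTE x0).
  have bf k : k <= n -> bounded (M + k * g) (iteri k f s).
    elim: k => [|k IHk] lt_kn; first by rewrite addn0.
    rewrite mulSnr addnA iteriS.
    have b1 : bounded (M + k * g) (set_reg (iteri k f s) x k).
      by apply: bounded_set_reg; [apply/IHk/ltnW | lia].
    have [||//] := IH1 _ _ wf1 _ r10 b1; last exact: ltp.
    by rewrite /= eq_sym (negbTE x0).
  split; first by apply: bounded_set_reg; [apply: bf | lia].
  have loop k j : k + j = n ->
      exists2 t,
        exec w (While (Bin OpLt (Reg x) (Reg 0))
                  (Seq (compile p1) (SetReg x (Bin OpAdd (Reg x) (Cst 1)))))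
               (set_reg (iteri k f s) x k) t (set_reg (iteri n f s) x n)
      & t <= j * (cost p1 n + 8) + 4.
    have test i : i <= n -> eval w (set_reg (iteri i f s) x i)
        (Bin OpLt (Reg x) (Reg 0)) = Some (i < n : nat).
      move=> le_in; rewrite /= /word eqxx (eq_sym 0) (negbTE x0) f0.
      have -> : i < 2 ^ w by lia.
      have -> : n < 2 ^ w by lia.
      have -> : (i < n : nat) < 2 ^ w by apply: leq_ltn_trans (leq_b1 _) _; lia.
      by [].
    elim: j k => [|j IHj] k Ekn.
      rewrite addn0 in Ekn; rewrite {}Ekn; exists 4 => //.
      by apply: ExecWhileEnd; rewrite test // ltnn.
    have lt_kn : k < n by lia.
    have b1 : bounded (M + k * g) (set_reg (iteri k f s) x k).
      by apply: bounded_set_reg; [apply/bf/ltnW | lia].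
    have [|bM1 [t1 ex1 let1]] := IH1 _ _ wf1 _ r10 b1 (ltp _ lt_kn).
      by rewrite /= eq_sym (negbTE x0).
    have [t2 ex2 let2] := IHj k.+1 ltac:(lia).
    (* The test costs 3, the increment 4 and the loop step 1: these are the 8 steps per iteration in
       [cost]. The final test costs 4 and the initialisation 2, whence the 6. *)
    exists (3 + (t1 + 4) + t2).+1; last by lia.
    apply: (ExecWhileLoop (v := 1)) ex2 => //;
      first by rewrite (test k (ltnW lt_kn)) lt_kn.
    apply: ExecSeq ex1 _; rewrite iteriS -/(f k _).
    have rx : reg (f k (iteri k f s)) x = k by rewrite run_reg //= eqxx.
    apply: (@ExecSetReg w x (Bin OpAdd (Reg x) (Cst 1))).
    rewrite /= rx /word.
    have -> : k < 2 ^ w by lia.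
    have -> : 1 < 2 ^ w by lia.
    by rewrite /= addn1; have -> : k.+1 < 2 ^ w by lia.
  have [t ex let_] := loop 0 n erefl.
  exists (2 + t); last by lia.
  apply: ExecSeq ex; apply: (@ExecSetReg w x (Cst 0)).
  by rewrite /= /word; have -> : 0 < 2 ^ w by lia.
Qed.

(** * Polynomial bounds on running time and word length *)

Lemma cost_depth p :
  exists K, forall n, cost p n <= K * n.+1 ^ depth p.
Proof.
have pw d1 d2 n : d1 <= d2 -> n.+1 ^ d1 <= n.+1 ^ d2 by apply: leq_pexp2l.
elim: p => [|x e|b e1 e2|p1 [K1 IH1] p2 [K2 IH2]|e p1 [K1 IH1] p2 [K2 IH2]
           |x p1 [K1 IH1]] /=.
- by exists 1 => n.
- by exists (ecost e).+1 => n; rewrite muln1.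
- by exists (ecost e1 + ecost e2).+1 => n; rewrite muln1.
- exists (K1 + K2) => n.
  have := pw _ _ n (leq_maxl (depth p1) (depth p2)).
  have := pw _ _ n (leq_maxr (depth p1) (depth p2)).
  by move: (IH1 n) (IH2 n); nia.
- exists (K1 + K2 + (ecost e).+1) => n.
  have := pw _ _ n (leq_maxl (depth p1) (depth p2)).
  have := pw _ _ n (leq_maxr (depth p1) (depth p2)).
  have : 0 < n.+1 ^ maxn (depth p1) (depth p2) by rewrite expn_gt0.
  by move: (IH1 n) (IH2 n); nia.
- exists (K1 + 14) => n; rewrite expnS.
  have : 0 < n.+1 ^ depth p1 by rewrite expn_gt0.
  by move: (IH1 n); nia.
Qed.

Definition poly_bounded (f : nat -> nat) : Prop :=
  exists K d, forall n, f n <= K * n.+1 ^ d.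

Lemma poly_bounded_cst k : poly_bounded (fun=> k).
Proof. by exists k, 0 => n; rewrite muln1. Qed.

Lemma poly_bounded_id : poly_bounded id.
Proof. by exists 1, 1 => n; rewrite mul1n expn1. Qed.

Lemma poly_bounded_add f g : poly_bounded f -> poly_bounded g ->
  poly_bounded (fun n => f n + g n).
Proof.
move=> [K1 [d1 H1]] [K2 [d2 H2]]; exists (K1 + K2), (d1 + d2) => n.
have : 0 < n.+1 ^ d1 by rewrite expn_gt0.
have : 0 < n.+1 ^ d2 by rewrite expn_gt0.
by rewrite expnD; move: (H1 n) (H2 n); nia.
Qed.

Lemma poly_bounded_mul f g : poly_bounded f -> poly_bounded g ->
  poly_bounded (fun n => f n * g n).
Proof.
move=> [K1 [d1 H1]] [K2 [d2 H2]]; exists (K1 * K2), (d1 + d2) => n.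
by rewrite expnD mulnACA leq_mul.
Qed.

Lemma poly_bounded_growth p : poly_bounded (growth p).
Proof.
elim: p => [|x e|b e1 e2|p1 IH1 p2 IH2|e p1 IH1 p2 IH2|x p1 IH1] /=.
1-3: exact: poly_bounded_cst.
1-2: exact: poly_bounded_add.
exact: poly_bounded_mul poly_bounded_id _.
Qed.

Lemma poly_bounded_emax e f :
  poly_bounded f -> poly_bounded (fun n => emax e (f n)).
Proof.
move=> bf; have bS g : poly_bounded g -> poly_bounded (fun n => (g n).+1).
  move=> [K [d H]]; exists K.+1, d => n.
  have : 0 < n.+1 ^ d by rewrite expn_gt0.
  by move: (H n); nia.
elim: e => [k|x|b e1 IH1|o e1 IH1 e2 IH2] //=.
- exact: poly_bounded_cst.
- exact: poly_bounded_add.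
- case: o; try by apply/bS/poly_bounded_add.
  by apply: poly_bounded_add;
    [apply: poly_bounded_add | apply: poly_bounded_mul].
Qed.

Lemma poly_bounded_pmax p f :
  poly_bounded f -> poly_bounded (fun n => pmax p (f n)).
Proof.
move=> bf.
elim: p => [|x e|b e1 e2|p1 IH1 p2 IH2|e p1 IH1 p2 IH2|x p1 IH1] /=.
- exact: poly_bounded_cst.
- exact: poly_bounded_emax.
- by apply: poly_bounded_add; apply: poly_bounded_emax.
- exact: poly_bounded_add.
- by do 2?apply: poly_bounded_add => //; apply: poly_bounded_emax.
- apply: poly_bounded_add => //.
  have [K [d H]] := poly_bounded_add bf bf; exists K.+1, d => n.
  have : 0 < n.+1 ^ d by rewrite expn_gt0.
  by move: (H n); nia.
Qed.

Lemma bigO_up_log f : poly_bounded f ->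
  bigO (fun n => up_log 2 (f n).+1) (fun n => up_log 2 n).
Proof.
move=> [K [d H]]; exists (K.+1 + 2 * d), 2 => n n2.
have L1 : 0 < up_log 2 n by rewrite up_log_gt0 // n2.
suff le2 : up_log 2 (f n).+1 <= K.+1 + 2 * d * up_log 2 n by nia.
apply: up_log_min => //; rewrite expnD.
have fn : (f n).+1 <= K.+1 * n.+1 ^ d.
  have : 0 < n.+1 ^ d by rewrite expn_gt0.
  by move: (H n); nia.
apply: leq_trans fn _; apply: leq_mul; first by rewrite ltnW // ltn_expl.
(* For n at least 2, n + 1 is at most n squared; this is the origin of the factor 2 and of the
   threshold 2. *)
have le_nn : n.+1 <= 2 ^ (2 * up_log 2 n).
  apply: (@leq_trans (n * n)); first by nia.
  by rewrite mul2n -addnn expnD leq_mul // up_logP.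
rewrite mulnAC expnM.
by case: (d) => // d'; rewrite leq_exp2r.
Qed.

(** * Preference tables *)

Lemma index_filter (T : eqType) (a : pred T) (s : seq T) x :
  a x -> x \in s -> index x (filter a s) = count a (take (index x s) s).
Proof.
move=> ax; elim: s => //= y s IHs; rewrite inE (eq_sym x).
case: eqVneq => [-> _|neq_yx /= xs]; first by rewrite ax /= eqxx.
by case: ifP => /= ay; rewrite ?(negbTE neq_yx) IHs.
Qed.

Section Table.

Variables (n : nat) (I : sf_instance n).
Implicit Types (i j k : 'I_n) (t : 'I_n -> nat).

Local Notation c := (cap I).

Definition rk i j : nat := index j (pref_list I i).

Lemma mem_pref_list i j : (j \in pref_list I i) = (j != i).
Proof. by rewrite mem_sort mem_enum. Qed.

Lemma pref_list_uniq i : uniq (pref_list I i).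
Proof. by rewrite sort_uniq enum_uniq. Qed.

Lemma size_pref_list i : size (pref_list I i) = n.-1.
Proof. by rewrite size_sort -cardE cardC1 card_ord. Qed.

Lemma rk_le i j : rk i j <= n.-1.
Proof. by rewrite -(size_pref_list i) index_size. Qed.

Lemma rk_lt i j : rk i j < n.
Proof. by move: (rk_le i j) (ltn_ord i); lia. Qed.

Lemma rk_self i : rk i i = n.-1.
Proof.
by rewrite -(size_pref_list i); apply: memNindex; rewrite mem_pref_list eqxx.
Qed.

Lemma rk_lt_neq i j : (rk i j < n.-1) = (j != i).
Proof. by rewrite -mem_pref_list -index_mem size_pref_list. Qed.

Lemma nth_rk i j : nth i (pref_list I i) (rk i j) = j.
Proof.
have [->|neq_ji] := eqVneq j i;
  first by rewrite nth_default ?rk_self ?size_pref_list.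
by rewrite nth_index ?mem_pref_list.
Qed.

Lemma rk_nth i m : m < n -> rk i (nth i (pref_list I i) m) = m.
Proof.
move=> lt_mn; have [lt_mn1|le_n1m] := ltnP m n.-1.
  by rewrite /rk index_uniq ?pref_list_uniq ?size_pref_list.
rewrite nth_default ?size_pref_list // rk_self; lia.
Qed.

Lemma rk_inj i : injective (rk i).
Proof. by move=> j k eq_jk; rewrite -(nth_rk i j) eq_jk nth_rk. Qed.

Lemma pref_asym i a b : pref I i a b -> ~~ pref I i b a.
Proof.
by move=> ab; apply/negP => /(pref_trans ab); rewrite pref_irr.
Qed.

Lemma pref_list_sorted i : sorted (wpref I i) (pref_list I i).
Proof.
apply: sort_sorted => a b; rewrite /wpref.
by have [->|/(pref_total I i)/orP[]->] := eqVneq a b; rewrite ?orbT.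
Qed.

Lemma wpref_trans i : transitive (wpref I i).
Proof.
move=> b a d /predU1P[->//|ab] /predU1P[<-|bd]; first by rewrite /wpref ab orbT.
by rewrite /wpref (pref_trans ab bd) orbT.
Qed.

Lemma pref_rk i a b : pref I i a b = (rk i a < rk i b).
Proof.
have lt_pref x y : rk i x < rk i y -> pref I i x y.
  move=> lt_xy; have neq_xy : x != y by apply: contraTneq lt_xy => ->;
    rewrite ltnn.
  (* Sortedness speaks only of the agents in the list, so [i] itself, which has rank [n.-1], is
     treated separately. *)
  have [Ey|neq_yi] := eqVneq y i.
    by rewrite Ey; apply: pref_self_last; rewrite -Ey.
  have neq_xi : x != i by rewrite -rk_lt_neq (leq_trans lt_xy) ?rk_le.
  have := sorted_ltn_index (@wpref_trans i) (pref_list_sorted i).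
  move=> /(_ x y); rewrite !mem_pref_list => /(_ neq_xi neq_yi lt_xy).
  by rewrite /wpref (negbTE neq_xy).
case: (ltngtP (rk i a) (rk i b)) => [/lt_pref//|/lt_pref/pref_asym/negbTE//|].
by move/rk_inj->; apply: pref_irr.
Qed.

(* [t j] is the position in the list of [j] of the worst agent that [j] still
   accepts; position [n.-1], just past the end of the list, stands for [j]
   itself, which is also the default value of [nth] in [worst]. *)
Definition tab t i j : bool := [&& i != j, rk i j <= t i & rk j i <= t j].
Definition entries t i : seq 'I_n := filter (tab t i) (pref_list I i).
Definition len t i : nat := count (tab t i) (pref_list I i).
Definition pos t i j : nat := count (tab t i) (take (rk i j) (pref_list I i)).
Definition out t i j : bool := tab t i j && (pos t i j < c i).
Definition inn t j : {set 'I_n} := [set i | out t i j].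
Definition sec t i : 'I_n := nth i (entries t i) (c i).
Definition worst t j : 'I_n := nth j (pref_list I j) (t j).
Definition nxt t i : 'I_n := worst t (sec t i).

Lemma tab_sym t i j : tab t i j = tab t j i.
Proof. by rewrite /tab eq_sym [X in _ && X]andbC. Qed.

Lemma tab_pref_list t i j : tab t i j -> j \in pref_list I i.
Proof. by case/and3P; rewrite mem_pref_list eq_sym. Qed.

Lemma mem_entries t i j : (j \in entries t i) = tab t i j.
Proof. by rewrite mem_filter andb_idr // => /tab_pref_list. Qed.

Lemma entries_uniq t i : uniq (entries t i).
Proof. exact/filter_uniq/pref_list_uniq. Qed.

Lemma size_entries t i : size (entries t i) = len t i.
Proof. by rewrite size_filter. Qed.

Lemma card_tab t i : #|[set j | tab t i j]| = len t i.
Proof.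
rewrite -size_entries -(card_uniqP (entries_uniq t i)).
by apply: eq_card => j; rewrite inE mem_entries.
Qed.

Lemma pos_index t i j : tab t i j -> pos t i j = index j (entries t i).
Proof. by move=> tij; rewrite index_filter ?(tab_pref_list tij). Qed.

Lemma pos_lt t i j : tab t i j -> pos t i j < len t i.
Proof.
by move=> tij; rewrite pos_index // -size_entries index_mem mem_entries.
Qed.

Lemma pos_inj t i j k :
  tab t i j -> tab t i k -> pos t i j = pos t i k -> j = k.
Proof.
move=> tij tik; rewrite !pos_index // => /(congr1 (nth i (entries t i))).
by rewrite !nth_index ?mem_entries.
Qed.

Lemma leq_pos t i j k : rk i j <= rk i k -> pos t i j <= pos t i k.
Proof.
move=> le_jk; rewrite /pos -(take_takel (pref_list I i) le_jk).
exact/leq_count_subseq/take_subseq.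
Qed.

Lemma pos_card t i j :
  pos t i j = #|[set k | tab t i k & rk i k < rk i j]|.
Proof.
rewrite /pos -size_filter.
rewrite -(card_uniqP (filter_uniq _ (take_uniq _ (pref_list_uniq i)))).
apply: eq_card => k; rewrite inE mem_filter; apply: andb_id2l => tik.
by rewrite in_take ?(tab_pref_list tik).
Qed.

Lemma card_out t i : #|[set j | out t i j]| = minn (c i) (len t i).
Proof.
rewrite -size_entries -size_take_min.
rewrite -(card_uniqP (take_uniq _ (entries_uniq t i))); apply: eq_card => j.
rewrite inE /out -mem_entries.
have [js|/negbTE jNs] := boolP (j \in entries t i).
  by rewrite in_take // -pos_index // -mem_entries.
by apply/esym; apply: contraFF jNs; apply: mem_take.
Qed.

Lemma secP t i : c i < len t i -> tab t i (sec t i) /\ pos t i (sec t i) = c i.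
Proof.
rewrite -size_entries => lt_c.
have ts : tab t i (sec t i) by rewrite -mem_entries mem_nth.
by split; rewrite // pos_index // index_uniq ?entries_uniq.
Qed.

Lemma rk_worst t j : t j <= n.-1 -> rk j (worst t j) = t j.
Proof. by move=> le_t; rewrite rk_nth //; move: (ltn_ord j) le_t; lia. Qed.

Lemma worst_eq t j i : t j <= n.-1 -> (rk j i == t j) = (i == worst t j).
Proof. by move=> le_t; rewrite -{1}(rk_worst le_t) (inj_eq (@rk_inj j)). Qed.

(** No entry ranks below the threshold, so the threshold agent, if it is an entry, is the last
    one. *)
Lemma pos_worst t j : t j <= n.-1 -> tab t j (worst t j) ->
  (pos t j (worst t j)).+1 = len t j.
Proof.
move=> le_t tw; apply/eqP; rewrite eqn_leq pos_lt //=.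
have s0 : 0 < size (entries t j).
  by rewrite size_entries (leq_trans _ (pos_lt tw)).
set k := nth j (entries t j) (size (entries t j)).-1.
have tk : tab t j k by rewrite -mem_entries mem_nth // prednK.
have : pos t j k <= pos t j (worst t j).
  by apply: leq_pos; rewrite rk_worst //; case/and3P: tk.
rewrite (pos_index tk) index_uniq ?entries_uniq ?prednK // size_entries.
by move: s0; rewrite size_entries; lia.
Qed.

(* An agent that has rejected somebody receives enough proposals forever. *)
Definition inv t : Prop :=
  forall j, t j <= n.-1 /\ (t j < n.-1 -> c j <= #|inn t j|).
(** The threshold agent need not be an entry. In that case the condition only says that [j] is
    filled, and moving the threshold leaves the table unchanged. *)
Definition trim t j : bool := c j <= #|inn t j :\ worst t j|.
Definition dec t (J : {set 'I_n}) : 'I_n -> nat := fun j => t j - (j \in J).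

Lemma inn_tab t j : inn t j \subset [set i | tab t j i].
Proof. by apply/subsetP => i; rewrite !inE tab_sym => /andP[]. Qed.

Lemma cap_gt0 j : 0 < c j. Proof. by have /andP[] := cap_bounds I j. Qed.

(** * Lowering the thresholds of a set of agents *)

Section Dec.

Variables (t : 'I_n -> nat) (J : {set 'I_n}).
Hypotheses (le_t : forall j, t j <= n.-1) (t0 : {in J, forall j, 0 < t j}).

Lemma tab_dec i j : tab (dec t J) i j =
  [&& tab t i j, ~~ ((i \in J) && (j == worst t i))
                & ~~ ((j \in J) && (i == worst t j))].
Proof.
have le1 a b : (rk a b <= dec t J a) =
    (rk a b <= t a) && ~~ ((a \in J) && (b == worst t a)).
  rewrite /dec -worst_eq //; case: (boolP (a \in J)) => [/t0|_];
    last by rewrite subn0 andbT.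
  by move=> t_gt0 /=; move: (rk a b) (t a) t_gt0 => x y; lia.
by rewrite /tab !le1; case: (i != j) => //=; rewrite andbACA -!andbA;
  do !bool_congr.
Qed.

Lemma tab_dec_sub i : subpred (tab (dec t J) i) (tab t i).
Proof. by move=> j; rewrite tab_dec => /and3P[]. Qed.

Lemma pos_dec i j : pos (dec t J) i j <= pos t i j.
Proof. by apply: sub_count; apply: tab_dec_sub. Qed.

Lemma pos_dec_lt i j k : tab t i k -> ~~ tab (dec t J) i k ->
  rk i k < rk i j -> pos (dec t J) i j < pos t i j.
Proof.
move=> tik ntik lt_kj; rewrite !pos_card; apply/proper_card/properP; split.
  by apply/subsetP => m; rewrite !inE => /andP[/tab_dec_sub-> ->].
by exists k; rewrite !inE ?tik ?lt_kj ?(negbTE ntik).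
Qed.

Hypothesis worst_out : {in J, forall j, ~~ out t j (worst t j)}.

(** A proposal is lost only when its receiver drops it: deletions can only improve its position in
    the list of the proposer, and by [worst_out] the proposer does not drop anyone to whom it
    proposes. *)
Lemma out_dec i j :
  out t i j -> ~~ ((j \in J) && (i == worst t j)) -> out (dec t J) i j.
Proof.
move=> oij nij; have /andP[tij lt_c] := oij.
rewrite /out tab_dec tij nij andbT (leq_ltn_trans (pos_dec i j) lt_c) andbT.
by apply/negP => /andP[/worst_out + /eqP Ej]; rewrite -Ej oij.
Qed.

Lemma inv_dec : inv t ->
  {in J, forall j, c j <= #|inn (dec t J) j|} -> inv (dec t J).
Proof.
move=> invt invJ j; have [le_tj t_inn] := invt j.
split; first by apply: leq_trans le_tj; apply: leq_subr.
have [/invJ //|jJ] := boolP (j \in J).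
rewrite /dec (negbTE jJ) subn0 => /t_inn le_c; apply: leq_trans le_c _.
apply/subset_leq_card/subsetP => i; rewrite !inE => /out_dec; apply.
by rewrite (negbTE jJ).
Qed.

Lemma sum_dec : J != set0 -> \sum_j dec t J j < \sum_j t j.
Proof.
case/set0Pn => j jJ; rewrite (bigD1 j) //= [X in _ < X](bigD1 j) //= -addSn.
apply: leq_add; first by rewrite /dec jJ subn1 prednK ?t0.
by apply: leq_sum => i _; apply: leq_subr.
Qed.

End Dec.

(** If [j] proposed to its last entry, it would have at most [c j] entries, hence fewer than [c j]
    besides the worst one, whereas [trim] provides [c j] proposers among these. *)
Lemma trim_worst_out t j : t j <= n.-1 -> trim t j -> ~~ out t j (worst t j).
Proof.
move=> le_t trj; apply/negP => /andP[tw]; rewrite -ltnS pos_worst // ltnS.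
apply/negP; rewrite -ltnNge; apply: leq_ltn_trans trj _.
rewrite -card_tab (cardsD1 (worst t j)) inE tw ltnS.
exact/subset_leq_card/setSD/inn_tab.
Qed.

Lemma trim_gt0 t j : t j <= n.-1 -> trim t j -> 0 < t j.
Proof.
move=> le_t trj; have: 0 < #|inn t j :\ worst t j|.
  exact: leq_trans (cap_gt0 j) trj.
case/card_gt0P => i; rewrite !inE -worst_eq // =>
  /andP[neq /andP[/and3P[_ _ le]]] _.
by move: neq le; case: (t j) => //; rewrite leqn0 => /negbTE->.
Qed.

Lemma trim_step t : inv t -> inv (dec t [set j | trim t j]).
Proof.
move=> invt; have le_t j : t j <= n.-1 by have [] := invt j.
have t0 : {in [set j | trim t j], forall j, 0 < t j}.
  by move=> j; rewrite inE; apply: trim_gt0.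
have wo : {in [set j | trim t j], forall j, ~~ out t j (worst t j)}.
  by move=> j; rewrite inE; apply: trim_worst_out.
apply: inv_dec => // j; rewrite inE => trj; apply: leq_trans trj _.
apply/subset_leq_card/subsetP => i; rewrite !inE => /andP[neq oij].
by apply: out_dec => //; rewrite (negbTE neq) andbF.
Qed.

(** * Tables in which no threshold is to be trimmed *)

Section Trimmed.

Variable t : 'I_n -> nat.
Hypotheses (inv_t : inv t) (trimmed : forall j, ~~ trim t j).

Let le_t j : t j <= n.-1. Proof. by have [] := inv_t j. Qed.

Lemma card_inn_le j : #|inn t j| <= c j.
Proof.
have := trimmed j; rewrite /trim -ltnNge => lt_c; apply: leq_trans lt_c.
by rewrite (cardsD1 (worst t j)) -add1n leq_add2r leq_b1.
Qed.

(** Double counting: [j] receives at most [minn (c j) (len t j)] proposals, which is the number it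
    makes. Since the totals of proposals received and made coincide, no inequality is strict. *)
Lemma card_inn j : #|inn t j| = minn (c j) (len t j).
Proof.
have le_io k : #|inn t k| <= #|[set i | out t k i]| ?= iff
    (#|inn t k| == #|[set i | out t k i]|).
  apply/leqifP; case: eqVneq => // neq; rewrite ltn_neqAle neq card_out leq_min.
  by rewrite card_inn_le -card_tab subset_leq_card ?inn_tab.
have [_] := leqif_sum (fun k _ => le_io k) (P := xpredT).
have -> : \sum_k #|inn t k| = \sum_k #|[set i | out t k i]|.
  rewrite (eq_bigr (fun k => \sum_i out t i k)); last first.
    by move=> k _; rewrite -sum1dep_card big_mkcond; apply: eq_bigr => i _;
      case: out.
  rewrite exchange_big; apply: eq_bigr => i _.
  by rewrite -sum1dep_card [RHS]big_mkcond; apply: eq_bigr => k _; case: out.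
by rewrite eqxx => /esym/forallP/(_ j)/eqP->; rewrite card_out.
Qed.

Lemma worst_inn j : c j <= len t j -> out t (worst t j) j.
Proof.
move=> le_c; have := trimmed j; rewrite /trim -ltnNge => lt_c.
have : #|inn t j| = c j by rewrite card_inn; apply/minn_idPl.
rewrite (cardsD1 (worst t j)) inE; case: out => //= Ec.
by rewrite add0n in Ec; rewrite Ec ltnn in lt_c.
Qed.

(** Had the threshold ever moved, the invariant would give [j] at least [c j] proposals, more than
    it has entries. *)
Lemma threshold_max j : len t j < c j -> t j = n.-1.
Proof.
move=> lt_c; apply/eqP; rewrite eqn_leq le_t /= leqNgt;
  apply/negP => /(inv_t j).2.
by rewrite card_inn; lia.
Qed.

(** An entry to which [i] does not propose lies beyond its first [c i] entries. On the other side,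
    [j] has an entry that does not propose to it, so the minimum in [card_inn] must be [c j]. *)
Lemma tab_nout i j :
  tab t i j -> ~~ out t i j -> c i < len t i /\ c j < len t j.
Proof.
move=> tij noij; split.
  by apply: leq_ltn_trans (pos_lt tij); rewrite leqNgt; move: noij;
    rewrite /out tij.
have: #|inn t j| < #|[set k | tab t j k]|.
  apply/proper_card/properP; split; first exact: inn_tab.
  by exists i; rewrite inE // tab_sym.
by rewrite card_inn card_tab gtn_min ltnn orbF.
Qed.

Lemma worst_tab j : c j <= len t j -> tab t j (worst t j).
Proof. by move=> /worst_inn/andP[]; rewrite tab_sym. Qed.

Lemma worst_nout j : c j < len t j -> ~~ out t j (worst t j).
Proof.
move=> lt_c; have tw := worst_tab (ltnW lt_c).
by rewrite /out tw -leqNgt -ltnS pos_worst.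
Qed.

Lemma sec_nout i : c i < len t i -> ~~ out t i (sec t i).
Proof. by case/secP => ts ps; rewrite /out ts ps ltnn. Qed.

Lemma sec_active i : c i < len t i -> c (sec t i) < len t (sec t i).
Proof.
by move=> ai; have [ts _] := secP ai;
  case: (tab_nout ts (sec_nout ai)).
Qed.

Lemma worst_active j : c j < len t j -> c (worst t j) < len t (worst t j).
Proof.
by move=> aj; case: (tab_nout (worst_tab (ltnW aj)) (worst_nout aj)).
Qed.

Lemma nxt_active i : c i < len t i -> c (nxt t i) < len t (nxt t i).
Proof. by move=> /sec_active/worst_active. Qed.

Lemma iter_nxt_active m i :
  c i < len t i -> c (iter m (nxt t) i) < len t (iter m (nxt t) i).
Proof. by move=> ai; elim: m => //= m; apply: nxt_active. Qed.

(** Of the cap + 1 entries of [u], exactly cap propose to it, so a single one does not. *)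
Lemma nout_unique u a b : len t u = (c u).+1 ->
  tab t u a -> ~~ out t a u -> tab t u b -> ~~ out t b u -> a = b.
Proof.
move=> lu ta na tb nb.
have /cards1P[x Ex] : #|[set i | tab t u i] :\: inn t u| == 1.
  by rewrite cardsD (setIidPr (inn_tab t u)) card_tab card_inn lu; lia.
have: a \in [set x] by rewrite -Ex !inE ta na.
have: b \in [set x] by rewrite -Ex !inE tb nb.
by rewrite !inE => /eqP-> /eqP.
Qed.

(** Neither [a] nor [sec t i] proposes to [u]: for [a] it is the second choice, for [sec t i] the
    worst entry. They coincide by [nout_unique], so [u] is both second choice and worst entry of
    [a], which leaves [a] with cap + 1 entries. *)
Lemma short_back u a i : len t u = (c u).+1 ->
  c a < len t a -> sec t a = u -> c i < len t i -> nxt t i = u ->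
  sec t i = a /\ len t a = (c a).+1.
Proof.
move=> lu aa sau ai niu.
have asi := sec_active ai.
have Esi : sec t i = a.
  have [tas _] := secP aa; have := sec_nout aa; rewrite sau in tas * => nas.
  apply: (nout_unique lu); rewrite 1?tab_sym //.
    by rewrite -niu; apply/worst_tab/ltnW.
  by rewrite -niu; apply: worst_nout.
split=> //; have wa : worst t a = u by rewrite -Esi.
have [_ <-] := secP aa.
by rewrite -(pos_worst (le_t a)) ?wa ?sau // -wa; apply/worst_tab/ltnW.
Qed.

(** * Elimination of a rotation *)

Section Rotation.

Variable i0 : 'I_n.
Hypothesis long_i0 : (c i0).+1 < len t i0.

(** By the pigeonhole principle the walk is periodic after n steps, with period at most n. Hence the
    next n iterates are exactly the cycle, without its tail. *)
Definition cyc : {set 'I_n} := [set iter (n + k) (nxt t) i0 | k : 'I_n].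
Definition rot : {set 'I_n} := [set sec t x | x in cyc].

Lemma cyc_active x : x \in cyc -> c x < len t x.
Proof. by case/imsetP => k _ ->; apply/iter_nxt_active/ltnW. Qed.

Lemma iter_period : exists2 p, 0 < p <= n &
  forall m, n <= m -> iter m (nxt t) i0 = iter (m - p) (nxt t) i0.
Proof.
have: looping (nxt t) i0 n.
  apply: contraT; rewrite -looping_uniq => /card_uniqP.
  rewrite size_traject => Ec.
  by have := max_card [in traject (nxt t) i0 n.+1]; rewrite Ec card_ord ltnn.
case/trajectP => a lt_an Ea; exists (n - a); first by lia.
move=> m le_nm; have -> : m - (n - a) = (m - n) + a by lia.
by rewrite iterD -Ea -iterD subnK.
Qed.

Lemma iter_cyc m : n <= m -> iter m (nxt t) i0 \in cyc.
Proof.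
have [p /andP[p0 le_pn] per] := iter_period.
elim/ltn_ind: m => m IHm le_nm; have [lt_m2n|le_2nm] := ltnP m (n + n).
  have lt_mn : m - n < n by lia.
  by apply/imsetP; exists (Ordinal lt_mn) => //=; rewrite subnKC.
by rewrite per //; apply: IHm; lia.
Qed.

Lemma cyc_pred x : x \in cyc -> exists2 x', x' \in cyc & nxt t x' = x.
Proof.
have [p /andP[p0 le_pn] per] := iter_period.
case/imsetP => k _ ->; exists (iter (n + k + p).-1 (nxt t) i0).
  by apply: iter_cyc; lia.
rewrite -iterS prednK; last by lia.
by rewrite per ?addnK; last by lia.
Qed.

Lemma rot_active y : y \in rot -> c y < len t y.
Proof. by case/imsetP => x /cyc_active/sec_active + ->. Qed.

(* A cycle reached from an agent with more than [cap + 1] entries contains no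
   agent [x] whose second choice is its worst entry and is about to be
   deleted by [x] itself: such agents form whole cycles that are closed under
   [nxt]-preimages. *)
Lemma cyc_sec_worst x : x \in cyc -> x \in rot -> sec t x != worst t x.
Proof.
pose bad u := [/\ u \in cyc, len t u = (c u).+1 & exists2 a, a \in cyc & sec t
  a = u].
have bad_pred u i : bad u -> c i < len t i -> nxt t i = u -> bad i.
  case=> uC lu [a aC sau] ai niu.
  have step b : c b < len t b -> nxt t b = u ->
      sec t b = a /\ len t a = (c a).+1.
    by apply: short_back => //; apply: cyc_active.
  have [i1 i1C ni1] := cyc_pred uC; have [i2 i2C ni2] := cyc_pred aC.
  have [si la] := step i ai niu; have [si1 _] := step i1 (cyc_active i1C) ni1.
  have sec_tab b : c b < len t b -> sec t b = a -> tab t a b /\ ~~ out t b a.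
    by move=> ab <-; rewrite tab_sym sec_nout //; have [] := secP ab.
  have [tai nia] := sec_tab i ai si.
  have [tai1 nia1] := sec_tab i1 (cyc_active i1C) si1.
  (* The predecessor [i] is not assumed to be on the cycle, but it coincides with the predecessor
     [i1] that is: neither proposes to [a]. *)
  have Ei : i = i1 := nout_unique la tai nia tai1 nia1.
  have [si2 li1] := short_back la (cyc_active i1C) si1 (cyc_active i2C) ni2.
  by rewrite Ei; split=> //; exists i2.
move=> xC /imsetP[a aC Ex]; apply/eqP => sw.
have [_ px] := secP (cyc_active xC).
have lx : len t x = (c x).+1.
  by rewrite -px sw pos_worst ?worst_tab // ltnW ?cyc_active.
have : bad x by split=> //; exists a.
(* Badness passes from the iterate [n + k] back through all earlier ones to [i0], which has too many
   entries to be bad. *)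
case/imsetP: (xC) => k _ ->; elim: (n + k) => [[_ li0 _]|m IHm /= bm].
  by move: long_i0; rewrite li0 ltnn.
by apply/IHm/(bad_pred _ _ bm) => //; apply/iter_nxt_active/ltnW.
Qed.

(** With threshold 0 the second choice would be the first entry, while its position is the capacity,
    which is positive. *)
Lemma rot_gt0 : {in rot, forall j, 0 < t j}.
Proof.
move=> y /rot_active; rewrite lt0n => ay; apply/eqP => ty0.
have [ts _] := secP ay; have nos := sec_nout ay.
have : rk y (sec t y) == t y by case/and3P: ts => _ + _; rewrite ty0 leqn0.
have tw := worst_tab (ltnW ay); rewrite worst_eq // => /eqP sw.
have : pos t y (worst t y) = 0.
  by rewrite /pos rk_worst // ty0 take0.
have [_] := secP ay; rewrite sw => -> cy0.
by move: (cap_gt0 y); rewrite cy0.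
Qed.

Lemma rot_worst_out : {in rot, forall j, ~~ out t j (worst t j)}.
Proof. by move=> y /rot_active/worst_nout. Qed.

Lemma rotate_step : inv (dec t rot).
Proof.
apply: inv_dec => //; [exact: rot_gt0 | exact: rot_worst_out |].
move=> y yR; have ay := rot_active yR; have /imsetP[x xC Ey] := yR.
have ax := cyc_active xC; have [tx px] := secP ax; have nox := sec_nout ax.
rewrite -Ey in tx px nox.
have [x' x'C nx'] := cyc_pred xC; set y' := sec t x'.
have y'R : y' \in rot by apply: imset_f.
have ay' := rot_active y'R; have wy' : worst t y' = x by [].
have oxy' : out t x y' by rewrite -wy' worst_inn // ltnW.
have ox : out (dec t rot) x y.
  have tdx : tab (dec t rot) x y.
    rewrite tab_dec //; last exact: rot_gt0.
    rewrite tx /=; apply/andP; split.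
      apply/negP => /andP[xR /eqP Ew].
      by move: (cyc_sec_worst xC xR); rewrite -Ey -Ew eqxx.
    (* The worst entry of [y] proposes to [y], whereas [x] does not. *)
    rewrite yR /=; apply/eqP => Ex; move: (worst_inn (ltnW ay)).
    by rewrite -Ex (negbTE nox).
  (* [y'] precedes [y] in the list of [x], because [x] proposes to [y'] but not to [y]; its removal
     moves [y] to a position below [c x]. *)
  rewrite /out tdx -px; apply: (@pos_dec_lt _ _ le_t rot_gt0 _ _ y').
  - by case/andP: oxy'.
  - rewrite tab_dec //; last exact: rot_gt0.
    by rewrite y'R wy' eqxx !andbF.
  - rewrite ltnNge; apply/negP => /leq_pos - /(_ t).
    by rewrite px leqNgt; case/andP: oxy' => _ ->.
(* The new proposal of [x] makes up for the one withdrawn from [y]. *)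
have sub : x |: (inn t y :\ worst t y) \subset inn (dec t rot) y.
  apply/subsetP => i; rewrite in_setU1 in_setD1 inE inE =>
    /predU1P[->//|/andP[ni oi]].
  by apply: out_dec => //; [exact: rot_gt0 | exact: rot_worst_out | rewrite
    (negbTE ni) andbF].
apply: leq_trans (subset_leq_card sub).
rewrite cardsU1 !inE (negbTE nox) andbF /=.
have := card_inn y; rewrite (cardsD1 (worst t y)) inE worst_inn ?(ltnW ay) //
  (minn_idPl (ltnW ay)).
by move=> <-.
Qed.

End Rotation.

End Trimmed.

Definition final t : Prop :=
  [/\ inv t, forall j, ~~ trim t j & forall i, len t i <= (c i).+1].

Lemma inv_init : inv (fun=> n.-1).
Proof. by move=> j; rewrite leqnn ltnn. Qed.

End Table.

(** * Loading the preference lists *)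

Declare Scope expr_scope.
Delimit Scope expr_scope with X.
Bind Scope expr_scope with expr.
Arguments Bin _ _%_X _%_X.
Notation "e1 + e2" := (Bin OpAdd e1 e2) : expr_scope.
Notation "e1 - e2" := (Bin OpSub e1 e2) : expr_scope.
Notation "e1 * e2" := (Bin OpMul e1 e2) : expr_scope.
Notation "e1 < e2" := (Bin OpLt e1 e2) : expr_scope.
Notation "e1 == e2" := (Bin OpEq e1 e2) : expr_scope.
Arguments PSet _ _%_X.
Arguments PPut _ _%_X _%_X.
Arguments PIf _%_X _ _.
Arguments Get _ _%_X.
Declare Scope prog_scope.
Delimit Scope prog_scope with P.
Notation "p ;; q" := (PSeq p q) (at level 90, right associativity) : prog_scope.
Local Open Scope prog_scope.

Definition cell (i j : expr) : expr := (i * Reg 0 + j)%X.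

(* Conventions: registers 1 to 4 are loop counters and the others are scratch,
   except that 10 is the next free cell of the output and 11 the number of
   cycles written so far.  Bank 3 holds the ranks, 4 the thresholds, 5 the
   relation [out], 6 the numbers of proposals compared by [trim], 7 the
   preference lists completed with the agent itself, 8 [sec], 9 [len], 10 the
   agents whose threshold is to move, and 11 the successors on the long
   cycles. *)
Definition row_prog : prog :=
  PFor 4 (PPut 7 (cell (Reg 3) (Reg 4))
                 (Get 1 (Reg 3 * (Reg 0 - Cst 1) + Reg 4))).

Definition rank_prog : prog :=
  PFor 4 (PPut 3 (cell (Reg 3) (Get 7 (cell (Reg 3) (Reg 4)))) (Reg 4)).

(** The copy in [row_prog] runs one cell too far, past the [n - 1] cells of the agent's list. The
    next assignment replaces this cell by the agent itself, so that [worst] with its default value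
    becomes a plain memory access. *)
Definition init_prog : prog :=
  PFor 3 (row_prog ;;
          PPut 7 (cell (Reg 3) (Reg 0 - Cst 1)) (Reg 3) ;;
          rank_prog ;;
          PPut 4 (Reg 3) (Reg 0 - Cst 1)).

Lemma run_seq p q s : run (p ;; q) s = run q (run p s).
Proof. by []. Qed.

(** The step hypothesis comes with a frame: whatever the loop does not write still has its value
    from before the loop, so invariants need to mention only what changes. *)
Lemma run_for n (P : nat -> store -> Prop) x p s :
  reg s 0 = n -> x != 0 -> 0 \notin wregs p ->
  (forall k s' v, P k s' -> P k (set_reg s' x v)) ->
  P 0 s ->
  (forall (i : 'I_n) s', reg s' x = i ->
     (forall y, y \notin x :: wregs p -> reg s' y = reg s y) ->
     (forall b a, b \notin wbanks p -> mem s' b a = mem s b a) ->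
     P i s' -> P i.+1 (run p s')) ->
  P n (run (PFor x p) s).
Proof.
move=> s0 x0 p0 Px P0 PS.
have [|i s' [P' Hr Hm]|s' [Pn _ _] ->] := @run_for_ind n (fun k s' =>
    [/\ P k s', forall y, y \notin x :: wregs p -> reg s' y = reg s y
       & forall b a, b \notin wbanks p -> mem s' b a = mem s b a]) x p s s0.
- by split.
- split.
  + apply: PS => //=; first by rewrite eqxx.
    * by move=> y yx; rewrite Hr //; move: yx; rewrite inE => /norP[/negbTE->].
    * exact: Px.
  + move=> y yx; rewrite run_reg /=; last by move: yx; rewrite inE => /norP[].
    by rewrite Hr //; move: yx; rewrite inE => /norP[/negbTE->].
  + by move=> b a bp; rewrite run_mem //= Hm.
exact: Px.
Qed.

Lemma cell_eq n (i i' j j' : 'I_n) :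
  (i * n + j == i' * n + j') = (i == i') && (j == j').
Proof.
apply/eqP/andP => [E|[/eqP-> /eqP-> //]].
have [jn j'n] := (ltn_ord j, ltn_ord j').
have Ei : i = i' :> nat.
  have := congr1 (divn^~ n) E.
  by rewrite !divnMDl ?divn_small ?addn0 //; lia.
by split; apply/eqP/val_inj => //=; move: E; rewrite Ei; lia.
Qed.

Lemma nth_flatten_const (T : Type) (x0 : T) (ss : seq (seq T)) m i k :
  all (fun s => size s == m) ss -> i < size ss -> k < m ->
  nth x0 (flatten ss) (i * m + k) = nth x0 (nth [::] ss i) k.
Proof.
elim: ss i => //= s ss IHs [|i] /andP[/eqP Es Hss]; rewrite ltnS nth_cat Es.
  by rewrite mul0n add0n => _ ->.
move=> lt_i lt_k; rewrite ltnNge mulSn -addnA leq_addr /= addKn; exact: IHs.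
Qed.

Section Programs.

Variables (n : nat) (I : sf_instance n).
Implicit Types (i j k : 'I_n) (t : 'I_n -> nat) (s : store).

Local Notation c := (cap I).

Lemma input_cap i : mem (input_store I) 0 i = c i.
Proof.
by rewrite /= (nth_map i) ?size_enum_ord // nth_ord_enum.
Qed.

Lemma input_pref i m : m < n.-1 ->
  mem (input_store I) 1 (i * n.-1 + m) = nth i (pref_list I i) m.
Proof.
move=> lt_m /=; rewrite nth_flatten_const ?size_map ?size_enum_ord //.
  rewrite (nth_map i) ?size_enum_ord // nth_ord_enum (nth_map i) //.
  by rewrite size_pref_list.
  by apply/allP => _ /mapP[j _ ->]; rewrite size_map size_pref_list.
by rewrite -enumT size_enum_ord.
Qed.

Definition loaded s : Prop :=
  [/\ reg s 0 = n, forall i, mem s 0 i = c i,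
      forall i j, mem s 3 (i * n + j) = rk I i j
    & forall i k, mem s 7 (i * n + k) = nth i (pref_list I i) k].

Lemma row_progP s i : reg s 0 = n -> reg s 3 = i ->
  forall i' k, mem (run row_prog s) 7 (i' * n + k) =
    if i' == i then mem s 1 (i * n.-1 + k) else mem s 7 (i' * n + k).
Proof.
move=> s0 s3; pose P m s' := forall i' k, mem s' 7 (i' * n + k) =
  if (i' == i) && (k < m) then mem s 1 (i * n.-1 + k) else mem s 7 (i' * n + k).
have H : P n (run row_prog s).
  apply: run_for => // [? ?|k s' s4 Fr Fm IH i1 k1 /=]; first by rewrite andbF.
  rewrite s4 !Fr // s0 s3 Fm // cell_eq IH subn1 ltnS (leq_eqVlt k1) val_eqE.
  by case: (i1 == i); case: eqVneq => //= ->.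
by move=> i' k; rewrite H ltn_ord andbT.
Qed.

Lemma rank_progP s i : reg s 0 = n -> reg s 3 = i ->
  (forall k, mem s 7 (i * n + k) = nth i (pref_list I i) k) ->
  forall i' j, mem (run rank_prog s) 3 (i' * n + j) =
    if i' == i then rk I i j else mem s 3 (i' * n + j).
Proof.
move=> s0 s3 s7; pose P m s' := forall i' j, mem s' 3 (i' * n + j) =
  if (i' == i) && (rk I i j < m) then rk I i j else mem s 3 (i' * n + j).
have H : P n (run rank_prog s).
  apply: run_for => // [? ?|k s' s4 Fr Fm IH i1 j /=]; first by rewrite andbF.
  rewrite s4 !Fr // s0 s3 Fm // s7 cell_eq IH ltnS (leq_eqVlt (rk I i j)).
  have -> : (j == nth i (pref_list I i) k) = (rk I i j == k).
    by rewrite -{2}(rk_nth I i (ltn_ord k)) (inj_eq (@rk_inj _ I i)).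
  by case: (i1 == i); case: eqVneq => //= ->.
by move=> i' j; rewrite H rk_lt andbT.
Qed.

Lemma init_progP : let s := run init_prog (input_store I) in
  loaded s /\ forall i, mem s 4 i = n.-1.
Proof.
pose P m s' := [/\ forall i k, i < m -> mem s' 7 (i * n + k) = nth i (pref_list
  I i) k,
  forall i j, i < m -> mem s' 3 (i * n + j) = rk I i j
  & forall i, i < m -> mem s' 4 i = n.-1].
have [H7 H3 H4] : P n (run init_prog (input_store I)).
  apply: run_for => // i s s3 Fr Fm [IH7 IH3 IH4].
  have s0 : reg s 0 = n by rewrite Fr.
  have in0 : 0 < n by apply: leq_trans (ltn_ord i).
  rewrite !run_seq.
  move: (run row_prog s) (row_progP s0 s3) (@run_reg row_prog s) (@run_mem
    row_prog s).
  move=> s1 H7 Fr1 Fm1.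
  have s10 : reg s1 0 = n by rewrite Fr1.
  have s13 : reg s1 3 = i by rewrite Fr1.
  set p := PPut 7 _ _.
  have {}H7 i' k : i' <= i -> mem (run p s1) 7 (i' * n + k) = nth i' (pref_list
    I i') k.
    rewrite /= s10 s13 subn1 H7 => le_i.
    have lt1 : n.-1 < n by rewrite prednK.
    rewrite (@cell_eq n i' i k (Ordinal lt1)).
    have [Ei|neq_i] := eqVneq i' i; last first.
      by rewrite IH7 // ltn_neqAle le_i andbT val_eqE.
    rewrite Ei /=; case: eqVneq => [->|neq_k].
      by rewrite nth_default ?size_pref_list.
    rewrite Fm // input_pref //; move: (ltn_ord k);
      rewrite -val_eqE /= in neq_k; lia.
  move: (run p s1) H7 (@run_reg p s1) (@run_mem p s1) => s2 H7 Fr2 Fm2.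
  have s20 : reg s2 0 = n by rewrite Fr2.
  have s23 : reg s2 3 = i by rewrite Fr2.
  move: (run rank_prog s2) (rank_progP s20 s23 (fun k => H7 i k (leqnn i)))
        (@run_reg rank_prog s2) (@run_mem rank_prog s2) => s5 H3 Fr5 Fm5.
  split=> /= [i' k|i' j|i']; rewrite ltnS leq_eqVlt val_eqE => le_i.
  - by rewrite Fm5 // H7 // leq_eqVlt val_eqE.
  - rewrite H3; move: le_i; have [->//|_ /= lt_i] := eqVneq i' i.
    by rewrite Fm2 // Fm1 // IH3.
  - rewrite !Fr5 // s20 s23 subn1 val_eqE.
    by move: le_i; have [->//|_ /= lt_i] := eqVneq i' i;
      rewrite Fm5 // Fm2 // Fm1 // IH4.
split=> [|i]; last exact: H4.
split=> *; rewrite ?H7 ?H3 ?run_reg ?run_mem //.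
exact: input_cap.
Qed.

End Programs.

(** * Scanning the table *)

(** Products serve as conjunctions. Writing [Cst 0 <] in front of them turns the value into a bit of
    slope 0, as [wf] requires; a bare product has slope 2. *)
Definition scan_cell : prog :=
  PSet 5 (Get 7 (cell (Reg 3) (Reg 4))) ;;
  PSet 7 (Cst 0 < (Reg 4 + Cst 1 < Reg 0) * (Reg 4 < Get 4 (Reg 3) + Cst 1) *
                  (Get 3 (cell (Reg 5) (Reg 3)) < Get 4 (Reg 5) + Cst 1)) ;;
  PPut 5 (cell (Reg 3) (Reg 5)) (Cst 0 < Reg 7 * (Reg 6 < Get 0 (Reg 3))) ;;
  PPut 6 (Reg 5)
    (Get 6 (Reg 5) + (Cst 0 < Get 5 (cell (Reg 3) (Reg 5)) *
                              (Get 3 (cell (Reg 5) (Reg 3)) < Get 4 (Reg 5)))) ;;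
  PIf (Reg 7 * (Reg 6 == Get 0 (Reg 3))) (PPut 8 (Reg 3) (Reg 5)) PSkip ;;
  PSet 6 (Reg 6 + (Cst 0 < Reg 7)).

Definition scan_row : prog := PFor 4 scan_cell.

Definition scan_prog : prog :=
  PFor 3 (PPut 6 (Reg 3) (Cst 0)) ;;
  PFor 3 (PSet 6 (Cst 0) ;; scan_row ;; PPut 9 (Reg 3) (Reg 6)).

Lemma take_enum_ord n (i : 'I_n) :
  take i.+1 (enum 'I_n) = rcons (take i (enum 'I_n)) i.
Proof. by rewrite (take_nth i) ?size_enum_ord // nth_ord_enum. Qed.

Lemma take_enum_ord_all n : take n (enum 'I_n) = enum 'I_n.
Proof. by rewrite take_oversize ?size_enum_ord. Qed.

Section Programs.

Variables (n : nat) (I : sf_instance n) (t : 'I_n -> nat).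
Implicit Types (i j k : 'I_n) (s : store).

Local Notation c := (cap I).

Definition state s : Prop := loaded I s /\ forall i, mem s 4 i = t i.

Lemma count_take_row i k : count (tab I t i) (take k.+1 (pref_list I i)) =
  count (tab I t i) (take k (pref_list I i)) +
  tab I t i (nth i (pref_list I i) k).
Proof.
have [lt_k|le_k] := ltnP k n.-1.
  by rewrite (take_nth i) ?size_pref_list // -cats1 count_cat /= addn0.
rewrite !take_oversize ?size_pref_list ?(leqW le_k) //.
by rewrite nth_default ?size_pref_list // /tab eqxx addn0.
Qed.

Lemma scan_rowP s i : state s -> reg s 3 = i -> reg s 6 = 0 ->
  let s' := run scan_row s in
  [/\ reg s' 6 = len I t i,
      forall i' j, mem s' 5 (i' * n + j) =
        if i' == i then out I t i j : nat else mem s 5 (i' * n + j),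
      forall j, mem s' 6 j = mem s 6 j + (out I t i j && (rk I j i < t j))
    & forall i', mem s' 8 i' =
        if (i' == i) && (c i < len I t i) then sec I t i : nat else mem s 8 i'].
Proof.
case=> [[s0 Hc Hrk Hrow] Ht] s3 s6 s'.
pose P m s' := [/\ reg s' 6 = count (tab I t i) (take m (pref_list I i)),
      forall i' j, mem s' 5 (i' * n + j) =
        if (i' == i) && (rk I i j < m) then out I t i j : nat
        else mem s 5 (i' * n + j),
      forall j, mem s' 6 j =
        mem s 6 j + [&& rk I i j < m, out I t i j & rk I j i < t j]
    & forall i', mem s' 8 i' =
        if (i' == i) && (c i < reg s' 6) then sec I t i : nat else mem s 8 i'].
have [H6 Hout Hin Hsec] : P n s'.
  apply: run_for => // [|k {}s' s4 Fr Fm [IH6 IHout IHin IHsec]].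
    split=> [|i' j|j|i']; rewrite ?take0 ?s6 ?andbF ?addn0 //.
  set j := nth i (pref_list I i) k.
  have rkj : rk I i j = k by rewrite rk_nth.
  have Frame b a : b \notin [:: 5; 6; 8] -> mem s' b a = mem s b a by apply: Fm.
  have s'0 : reg s' 0 = n by rewrite Fr.
  have s'3 : reg s' 3 = i by rewrite Fr.
  have Hrow' : mem s' 7 (i * n + k) = j by rewrite Frame // Hrow.
  have Hrk' : mem s' 3 (j * n + i) = rk I j i by rewrite Frame // Hrk.
  (* Position [n.-1] of the completed row is [i] itself, so the first factor is the condition
     [i != j] of [tab]. *)
  have Htab : (0 < (k + 1 < n) * (k < t i + 1) * (rk I j i < t j + 1)) = tab I
    t i j.
    have nij : (k + 1 < n) = (i != j).
      by rewrite eq_sym -(rk_lt_neq I) rkj; move: (ltn_ord k); lia.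
    by rewrite !muln_gt0 !lt0b nij !addn1 !ltnS -andbA /tab rkj.
  have H6 : reg s' 6 = pos I t i j by rewrite IH6 /pos rkj.
  have Hout : (0 < tab I t i j * (reg s' 6 < c i)) = out I t i j.
    by rewrite muln_gt0 !lt0b H6.
  rewrite /scan_cell !run_seq /= s4 s'3 s'0 Hrow' Hrk' !(Frame 4) // !Ht.
  rewrite (Frame 0) // Hc !eqxx Htab Hout.
  have eq_j j' : (rk I i j' == k) = (j' == j) by rewrite -rkj (inj_eq (@rk_inj
    _ I i)).
  have tab_pos : (tab I t i j * (reg s' 6 == c i) != 0) = tab I t i j && (pos I
    t i j == c i).
    by rewrite -lt0n muln_gt0 !lt0b H6.
  rewrite tab_pos; split.
  - by case: ifP => _ /=; rewrite IH6 count_take_row lt0b.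
  - move=> i' j' /=; case: ifP => _ /=;
      rewrite cell_eq IHout ltnS (leq_eqVlt (rk I i j')) eq_j;
    by case: (i' == i); case: eqVneq => //= ->.
  - move=> j' /=; case: ifP => _ /=;
      rewrite !val_eqE muln_gt0 !lt0b !IHin ltnS (leq_eqVlt (rk I i j')) eq_j;
    by case: eqVneq => [->|] //=; rewrite rkj ltnn addn0.
  (* [sec] is stored at the entry where the count equals the capacity. The count then increases and
     satisfies the strict inequality of the invariant for the first time. *)
  - move=> i' /=; case: ifP => [/andP[tij /eqP Epos]|] /=; rewrite ?tij H6 lt0b.
      have [|ts ps] := @secP _ I t i; first by rewrite -Epos pos_lt.
      rewrite Epos addn1 leqnn andbT val_eqE.
      by rewrite (pos_inj ts tij) ?ps ?Epos // IHsec H6 Epos ltnn andbF;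
        case: eqP.
    rewrite IHsec H6; case: (tab I t i j) => /= [neq|]; last by rewrite addn0.
    by rewrite addn1 ltnS (leq_eqVlt (c i)) (eq_sym (c i)) neq.
split=> [|i' j|j|i']; first by rewrite H6 take_oversize // size_pref_list
  leq_pred.
- by rewrite Hout rk_lt andbT.
- by rewrite Hin rk_lt.
- by rewrite Hsec H6 take_oversize // size_pref_list leq_pred.
Qed.

Definition scanned s : Prop :=
  [/\ forall i j, mem s 5 (i * n + j) = out I t i j,
      forall j, mem s 6 j = #|inn I t j :\ worst I t j|,
      forall i, c i < len I t i -> mem s 8 i = sec I t i
    & forall i, mem s 9 i = len I t i].

Lemma scan_progP s : (forall j, t j <= n.-1) -> state s -> scanned (run
  scan_prog s).
Proof.
move=> le_t Hs; have [[s0 _ _ _] _] := Hs; rewrite /scan_prog run_seq.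
set p := PFor 3 (PPut 6 _ _).
have H0 : forall i, mem (run p s) 6 i = 0.
  pose P m s := forall i, i < m -> mem s 6 i = 0.
  have H : P n (run p s).
    apply: run_for => // i s' s'3 _ _ IH i' /=; rewrite s'3 ltnS leq_eqVlt.
    by case: eqP => //= _ /IH.
  by move=> i; apply: H.
move: (run p s) H0 (@run_reg p s) (@run_mem p s) => s1 H0 Fr1 Fm1.
have Hs1 : state s1.
  by have [[Hr Hc Hrk Hrow] Ht] := Hs; do !split; move=> *; rewrite ?Fr1 ?Fm1.
clear Fr1 Fm1 Hs s0 s p; have [[s10 _ _ _] _] := Hs1.
set p := (PSet 6 _ ;; _).
pose P m s := [/\ forall i j, i < m -> mem s 5 (i * n + j) = out I t i j,
  forall j, mem s 6 j =
    count (fun i => out I t i j && (rk I j i < t j)) (take m (enum 'I_n)),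
  forall i, i < m -> c i < len I t i -> mem s 8 i = sec I t i
  & forall i, i < m -> mem s 9 i = len I t i].
have [Ho Hi Hsec Hlen] : P n (run (PFor 3 p) s1).
  apply: run_for => //; first by split=> // j; rewrite take0 H0.
  move=> i s s3 Fr Fm [IHo IHi IHsec IHlen]; rewrite /p !run_seq.
  have Hs : state (run (PSet 6 (Cst 0)) s).
    have [[Hr Hc Hrk Hrow] Ht] := Hs1.
    by do !split; move=> *; rewrite ?run_reg ?run_mem // ?Fr ?Fm.
  have s3' : reg (run (PSet 6 (Cst 0)) s) 3 = i by [].
  have [] := scan_rowP Hs s3' (erefl _).
  move: (run scan_row _) (@run_reg scan_row (run (PSet 6 (Cst 0)) s))
    (@run_mem scan_row (run (PSet 6 (Cst 0)) s)) => s' Fr' Fm' H6 Ho Hi Hsec.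
  have s'3 : reg s' 3 = i by rewrite Fr'.
  split=> [i' j|j|i'|i'] /=.
  - rewrite ltnS leq_eqVlt val_eqE Ho; have [->//|_ /= lt_i] := eqVneq i' i.
    exact: IHo.
  - by rewrite Hi /= IHi take_enum_ord -cats1 count_cat /= addn0.
  - rewrite ltnS leq_eqVlt val_eqE Hsec;
      have [-> _ ->//|_ /= lt_i lt_c] := eqVneq i' i.
    exact: IHsec.
  - rewrite ltnS leq_eqVlt s'3 H6 val_eqE; have [->//|_ /= lt_i] := eqVneq i' i.
    by rewrite Fm' //= IHlen.
split=> [i j|j|i|i]; [exact: Ho | | exact: Hsec | exact: Hlen].
rewrite Hi take_enum_ord_all -size_filter.
rewrite -(card_uniqP (filter_uniq _ (enum_uniq 'I_n))); apply: eq_card => i.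
rewrite !inE mem_filter mem_enum andbT andbC;
  apply: andb_id2r => /andP[/and3P[_ _ le_i] _].
by rewrite -worst_eq // ltn_neqAle le_i andbT.
Qed.

End Programs.

(** * Updating the thresholds *)

Definition trim_prog : prog :=
  PSet 7 (Cst 0) ;;
  PFor 3 (PPut 10 (Reg 3) (Get 0 (Reg 3) < Get 6 (Reg 3) + Cst 1) ;;
          PSet 7 (Cst 0 < Reg 7 + Get 10 (Reg 3))).

Definition pick_prog : prog :=
  PSet 8 (Reg 0) ;;
  PFor 3 (PIf (Get 0 (Reg 3) + Cst 1 < Get 9 (Reg 3)) (PSet 8 (Reg 3)) PSkip).

Definition next_expr : expr :=
  Get 7 (cell (Get 8 (Reg 8)) (Get 4 (Get 8 (Reg 8)))).

(** The first n steps bring the walk onto its cycle, and the next n pass through all of it; marking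
    an agent twice does no harm. *)
Definition rot_prog : prog :=
  PFor 3 (PSet 8 next_expr) ;;
  PFor 3 (PPut 10 (Get 8 (Reg 8)) (Cst 1) ;; PSet 8 next_expr).

Definition dec_prog : prog :=
  PFor 3 (PPut 4 (Reg 3) (Get 4 (Reg 3) - Get 10 (Reg 3))).

(** Register 8 equal to n signals that no agent has more than cap + 1 entries. If nothing is to be
    trimmed either, bank 10 is 0 for every agent and [dec_prog] leaves the final table unchanged. *)
Definition update_prog : prog :=
  trim_prog ;;
  PIf (Reg 7) PSkip (pick_prog ;; PIf (Reg 8 < Reg 0) rot_prog PSkip) ;;
  dec_prog.

Section Programs.

Variables (n : nat) (I : sf_instance n) (t : 'I_n -> nat).
Implicit Types (i j k : 'I_n) (s : store).

Local Notation c := (cap I).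

Lemma state_run p s :
  all [predC wregs p] [:: 0] -> all [predC wbanks p] [:: 0; 3; 4; 7] ->
  state I t s -> state I t (run p s).
Proof.
move=> /=; rewrite !andbT => p0 /and4P[b0 b3 b4 b7] [[Hr Hc Hrk Hrow] Ht].
by do !split; move=> *; rewrite ?run_reg ?run_mem.
Qed.

Lemma trim_progP s : state I t s -> scanned I t s ->
  let s' := run trim_prog s in
  (forall i, mem s' 10 i = trim I t i) /\
  (reg s' 7 != 0) = [exists i, trim I t i].
Proof.
move=> [[s0 Hc _ _] _] [_ Hin _ _]; rewrite /trim_prog run_seq.
set p := (PPut 10 _ _ ;; _).
pose P m s := (forall i, i < m -> mem s 10 i = trim I t i) /\
   (reg s 7 != 0) = [exists (i : 'I_n | i < m), trim I t i].
have [Hm Hr] : P n (run (PFor 3 p) (run (PSet 7 (Cst 0)) s)).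
  apply: run_for => //.
    by split=> //=; apply/esym/negbTE/existsP => -[].
  move=> i s' s3 Fr Fm [IHm IHr].
  have E : (mem s' 0 i < mem s' 6 i + 1) = trim I t i.
    by rewrite !Fm //= Hc Hin addn1.
  rewrite /p run_seq /= s3 E; split=> [i'|] /=.
    by rewrite ltnS leq_eqVlt val_eqE; have [->//|_ /IHm] := eqVneq i' i.
  rewrite eqxx -lt0n lt0b addn_gt0 lt0b lt0n IHr.
  apply/orP/exists_inP => [[/exists_inP[j lt_j tj]|ti]|[j]].
  - by exists j => //; apply: ltnW.
  - by exists i.
  - rewrite ltnS leq_eqVlt val_eqE => /predU1P[->|lt_j tj]; first by right.
    by left; apply/exists_inP; exists j.
split=> [i|]; first exact: Hm.
by rewrite Hr; apply: eq_existsb => i; rewrite ltn_ord.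
Qed.

Lemma pick_progP s : state I t s -> scanned I t s ->
  let s' := run pick_prog s in
  (reg s' 8 = n /\ forall i, len I t i <= (c i).+1) \/
  (exists2 i : 'I_n, reg s' 8 = i & (c i).+1 < len I t i).
Proof.
move=> [[s0 Hc _ _] _] [_ _ _ Hlen]; rewrite /pick_prog run_seq.
set p := PIf _ _ _.
pose P m s := (reg s 8 = n /\ forall i, i < m -> len I t i <= (c i).+1) \/
  (exists2 i : 'I_n, reg s 8 = i & (c i).+1 < len I t i).
have H : P n (run (PFor 3 p) (run (PSet 8 (Reg 0)) s)).
  apply: run_for => //; first by left; rewrite /= s0.
  move=> i s' s3 Fr Fm IH; rewrite /p /= s3 !Fm //= Hc Hlen addn1 -lt0n lt0b.
  case: ltnP => [long|short]; first by right; exists i.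
  case: IH => [[IH8 IHs]|]; last by right.
  left; split=> // j; rewrite ltnS leq_eqVlt val_eqE => /predU1P[->//|/IHs//].
by case: H => [[H8 H]|]; [left; split=> // i; apply: H | right].
Qed.

Lemma rot_progP s i0 : state I t s -> scanned I t s -> inv I t ->
  (forall j, ~~ trim I t j) -> (c i0).+1 < len I t i0 -> reg s 8 = i0 ->
  (forall i, mem s 10 i = 0) ->
  forall i, mem (run rot_prog s) 10 i = (i \in rot I t i0).
Proof.
move=> Hs [_ _ Hsec _] inv_t trimmed long s8 m0; rewrite /rot_prog run_seq.
have [[s0 Hc Hrk Hrow] Ht] := Hs.
have le_t j : t j <= n.-1 by have [] := inv_t j.
have next s' (x : 'I_n) : reg s' 0 = n -> (forall b a, b \notin [:: 10] -> mem
  s' b a = mem s b a) ->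
    reg s' 8 = x -> c x < len I t x ->
    mem s' 8 (reg s' 8) = sec I t x /\ ev s' next_expr = nxt I t x.
  move=> s'0 Fm s'8 ax; rewrite /= s'8 s'0 !Fm // Hsec // Ht.
  have lt_t : t (sec I t x) < n by move: (le_t (sec I t x)) (ltn_ord x); lia.
  by split=> //; rewrite (Hrow _ (Ordinal lt_t)).
pose x m : 'I_n := iter m (nxt I t) i0.
have active m : c (x m) < len I t (x m) by apply/iter_nxt_active/ltnW.
set p := PFor 3 (PSet 8 next_expr).
have H8 : reg (run p s) 8 = x n.
  pose P m s' := reg s' 8 = x m.
  have H : P n (run p s).
    apply: run_for => // i s' _ Fr Fm IH.
    have [||_ E] := next s' _ _ _ IH (active i); first by rewrite Fr.
      by move=> b a _; rewrite Fm.
    by rewrite /P /= -/(x i.+1) -E.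
  exact: H.
have [Fr1 Fm1 {}m0 {}H8] : [/\ reg (run p s) 0 = n,
    forall b a, mem (run p s) b a = mem s b a, forall i, mem (run p s) 10 i = 0
    & reg (run p s) 8 = x n].
  by split=> // *; rewrite ?run_reg ?run_mem.
move: (run p s) Fr1 Fm1 m0 H8 => s1 s10 Fm1 m0 H8.
set q := (PPut 10 _ _ ;; _).
pose P m s' := reg s' 8 = x (n + m) /\ forall i,
  mem s' 10 i = [exists (k : 'I_n | k < m), sec I t (x (n + k)) == i].
have [_ H] : P n (run (PFor 3 q) s1).
  apply: run_for => //.
    split; first by rewrite addn0.
    by move=> i; rewrite m0; case: existsP => // -[].
  move=> k s' s3 Fr Fm [IH8 IHm].
  have [|b a nb|E1 E2] := next s' _ _ _ IH8 (active _); first by rewrite Fr.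
    by rewrite Fm // Fm1.
  rewrite /q run_seq; split.
    have [||_ E3] := next (run (PPut 10 (Get 8 (Reg 8)) (Cst 1)) s') _ _ _ IH8
      (active _).
    - by rewrite /= Fr.
    - by move=> b a nb; rewrite run_mem // Fm // Fm1.
    by rewrite addnS /x iterS -/(x _) -E3.
  move=> i; rewrite /= E1 IHm val_eqE.
  have [->|neq_i] := eqVneq i (sec _ _ _).
    have -> // : [exists (k' : 'I_n | k' < k.+1), sec I t (x (n + k')) ==
      sec I t (x (n + k))] by apply/exists_inP; exists k.
  congr (nat_of_bool _); apply/exists_inP/exists_inP => -[k' lt_k Ek].
    by exists k' => //; apply: ltnW.
  exists k' => //; move: lt_k;
    rewrite ltnS leq_eqVlt val_eqE => /predU1P[Ekk|//].
  by rewrite -Ekk eq_sym Ek in neq_i.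
move=> i; rewrite H; congr (nat_of_bool _).
apply/exists_inP/imsetP => [[k _ /eqP<-]|[_ /imsetP[k _ ->] ->]].
  by exists (x (n + k)) => //; apply: imset_f.
by exists k.
Qed.

Lemma dec_progP s (J : {set 'I_n}) : state I t s ->
  (forall i, mem s 10 i = (i \in J)) -> state I (dec t J) (run dec_prog s).
Proof.
move=> [[s0 Hc Hrk Hrow] Ht] HJ.
split; first by split=> *; rewrite ?run_reg ?run_mem.
pose P m s := forall i, mem s 4 i = if i < m then dec t J i else t i.
have H : P n (run dec_prog s).
  apply: run_for => // i s' s3 Fr Fm IH j /=.
  rewrite s3 val_eqE IH Fm // HJ IH ltnn ltnS (leq_eqVlt j) val_eqE.
  by have [->|] := eqVneq j i.
by move=> i; rewrite H ltn_ord.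
Qed.

Lemma update_progP s : state I t s -> scanned I t s -> inv I t ->
  exists t', [/\ state I t' (run update_prog s), inv I t'
    & (\sum_j t' j < \sum_j t j /\ ~ final I t) \/ final I t'].
Proof.
move=> Hs Hscan inv_t; have le_t j : t j <= n.-1 by have [] := inv_t j.
rewrite /update_prog run_seq run_seq.
have [Hm Hr] := trim_progP Hs Hscan.
have Hs1 := @state_run trim_prog s isT isT Hs.
have Hscan1 : scanned I t (run trim_prog s).
  by case: Hscan => *; split=> *; rewrite run_mem //; eauto.
move: (run trim_prog s) Hm Hr Hs1 Hscan1 => s1 Hm Hr Hs1 Hscan1.
set p := PIf _ _ _.
have E : run p s1 = if [exists i, trim I t i] then s1 else
  run (PIf (Reg 8 < Reg 0) rot_prog PSkip) (run pick_prog s1).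
  by rewrite -Hr.
rewrite {}E; case: existsP => [[j trj]|ntrim].
  exists (dec t [set j | trim I t j]); split.
  - by apply: dec_progP => // i; rewrite Hm inE.
  - exact: trim_step.
  - left; split; last by case=> _ /(_ j)/negP.
    apply: sum_dec => [i|]; first by rewrite inE; apply: trim_gt0.
    by apply/set0Pn; exists j; rewrite inE.
have trimmed j : ~~ trim I t j by apply/negP => trj; apply: ntrim; exists j.
have {}Hm i : mem s1 10 i = 0 by rewrite Hm (negbTE (trimmed i)).
have H8 := pick_progP Hs1 Hscan1.
have Hs2 := @state_run pick_prog s1 isT isT Hs1.
have Hscan2 : scanned I t (run pick_prog s1).
  by case: Hscan1 => *; split=> *; rewrite run_mem //; eauto.
have Hm2 i : mem (run pick_prog s1) 10 i = 0 by rewrite run_mem.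
move: (run pick_prog s1) H8 Hs2 Hscan2 Hm2 => s2 H8 Hs2 Hscan2 Hm2.
have [[s20 _ _ _] _] := Hs2.
have -> : run (PIf (Reg 8 < Reg 0) rot_prog PSkip) s2 =
    if reg s2 8 < n then run rot_prog s2 else s2.
  by move: s20; rewrite /= => ->; case: (reg s2 8 < n).
case: H8 => [[-> short]|[i0 H8 long]].
  rewrite ltnn; exists t; split=> //; last by right.
  have [Hl Ht'] := @dec_progP s2 set0 Hs2 (fun i =>
    etrans (Hm2 i) (esym (congr1 nat_of_bool (in_set0 i)))).
  by split=> // i; rewrite Ht' /dec in_set0 subn0.
rewrite H8 ltn_ord; exists (dec t (rot I t i0)); split.
- apply: dec_progP; first exact: state_run.
  exact: rot_progP.
- exact: rotate_step.
- left; split; last by case=> _ _ /(_ i0); rewrite leqNgt long.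
  apply: sum_dec => [i|]; first exact: rot_gt0.
  apply/set0Pn; exists (sec I t (iter (n + i0) (nxt I t) i0)).
  by apply/imset_f/imset_f.
Qed.

End Programs.

(** * The rounds and their number *)

Definition main_loop : prog := PFor 1 (PFor 2 (scan_prog ;; update_prog)).

Section MainLoop.

Variables (n : nat) (I : sf_instance n).

Lemma main_loopP s : state I (fun=> n.-1) s ->
  exists2 t, state I t (run main_loop s) & final I t.
Proof.
move=> Hs; have [[s0 _ _ _] _] := Hs.
(* The thresholds sum to [n * n.-1] initially, and each round before the final table lowers the sum
   by at least one. *)
pose Q m s := exists t, [/\ state I t s, inv I t
  & \sum_j t j + m <= n * n.-1 \/ final I t].
have Qstep m s' : Q m s' -> Q m.+1 (run (scan_prog ;; update_prog) s').
  case=> t [Hs' Hi Hm]; rewrite run_seq.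
  have Hscan := scan_progP (fun j => (Hi j).1) Hs'.
  have {}Hs' := @state_run _ _ _ scan_prog s' isT isT Hs'.
  have [t' [Hs2 Hi2 Hm2]] := update_progP Hs' Hscan Hi.
  exists t'; split=> //; case: Hm2 => [[lt_sum nfin]|]; last by right.
  by case: Hm => // le_m; left; rewrite addnS; apply: leq_trans le_m;
    rewrite ltn_add2r.
have: Q (n * n) (run main_loop s).
  apply: (@run_for n (fun m => Q (m * n))) => //.
  - exists (fun=> n.-1); split; [by [] | exact: inv_init | left].
    by rewrite sum_nat_const card_ord mul0n addn0.
  move=> i s' s'1 Fr Fm IH.
  rewrite mulSnr; apply: (@run_for n (fun m => Q (i * n + m))) => //.
  - by rewrite Fr.
  - by rewrite addn0.
  - by move=> k s2 _ _ _; rewrite addnS; apply: Qstep.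
case=> t [Ht Hi [le_nn|Hf]]; exists t => //.
(* After [n * n] rounds the first alternative is possible only for n = 0, where every table is
   final. *)
have n0 : n = 0 by move: {Hi Ht} (\sum_j t j) le_nn => m; case: (n) => // m';
  nia.
by split=> // i; have := ltn_ord i; rewrite [X in _ < X]n0.
Qed.

End MainLoop.

(** * The generalised stable partition of a final table *)

Section OrbitCycle.

Variables (n : nat) (s : {perm 'I_n}) (x : 'I_n).

(** Restriction to one orbit produces all three kinds of cycles uniformly: transpositions from
    [tperm i j], fixed points from the identity and the long cycles from [succ]. *)
Definition orbit_fun (y : 'I_n) : 'I_n := if y \in porbit s x then s y else y.

Lemma mem_porbit_perm y : (s y \in porbit s x) = (y \in porbit s x).
Proof. by rewrite -!eq_porbit_mem -(porbit_perm s 1 y) expg1. Qed.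

Lemma orbit_fun_inj : injective orbit_fun.
Proof.
move=> y z; rewrite /orbit_fun.
case: ifP => yx; case: ifP => zx //; first exact: perm_inj.
- by move=> E; rewrite -E mem_porbit_perm yx in zx.
- by move=> E; rewrite E mem_porbit_perm zx in yx.
Qed.

Lemma orbit_neq0 : porbit s x != set0.
Proof. by apply/set0Pn; exists x; apply: porbit_id. Qed.

Lemma orbit_on : perm_on (porbit s x) (perm orbit_fun_inj).
Proof.
apply/subsetP => y; rewrite inE permE /orbit_fun.
by case: ifP => //; rewrite eqxx.
Qed.

Lemma orbit_cycle a : a \in porbit s x ->
  porbit (perm orbit_fun_inj) a = porbit s x.
Proof.
move=> ax; have pow k : (perm orbit_fun_inj ^+ k)%g a = (s ^+ k)%g a.
  elim: k => [|k IHk]; first by rewrite !perm1.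
  rewrite !expgSr !permM IHk permE /orbit_fun.
  by rewrite -eq_porbit_mem (porbit_perm s k a) eq_porbit_mem ax.
have -> : porbit s x = porbit s a by apply/eqP; rewrite eq_sym eq_porbit_mem.
by apply/setP => y; apply/porbitP/porbitP => -[k ->]; exists k; rewrite pow.
Qed.

Definition orbit_cyc : cyc_perm n := CycPerm orbit_neq0 orbit_on orbit_cycle.

Lemma orbit_cycE y : cfun orbit_cyc y = if y \in porbit s x then s y else y.
Proof. exact: permE. Qed.

Lemma cinv_orbit_cyc y : y \in porbit s x -> cinv orbit_cyc (s y) = y.
Proof. by move=> yx; apply: (canLR (permK _)); rewrite orbit_cycE yx. Qed.

Lemma orbit_cyc_code :
  cycle_code orbit_cyc x = #|porbit s x| :: map val (traject s x #|porbit s x|).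
Proof.
congr (_ :: map _ _); apply: (@eq_from_nth _ x) => [|m];
  rewrite !size_traject //.
move=> lt_m; rewrite !nth_traject //; elim: m {lt_m} => //= m ->.
by rewrite orbit_cycE -permX mem_porbit.
Qed.

End OrbitCycle.

Section OrbitCycleExamples.

Variable n : nat.
Implicit Types i j k : 'I_n.

Lemma porbit_tperm i j : porbit (tperm i j) i = [set i; j].
Proof.
apply/setP => k; rewrite !inE; apply/porbitP/orP => [[m ->]|].
  elim: m => [|m IHm]; first by rewrite expg0 perm1 eqxx; left.
  by rewrite expgSr permM; case: IHm => /eqP->; rewrite ?tpermL ?tpermR; auto.
by case=> /eqP->; [exists 0; rewrite perm1 | exists 1; rewrite expg1 tpermL].
Qed.

Lemma cfun_tperm i j : cfun (orbit_cyc (tperm i j) i) = tperm i j.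
Proof.
apply/permP => k; rewrite orbit_cycE porbit_tperm !inE.
by case: ifP => // /norP[ki kj]; rewrite tpermD // eq_sym.
Qed.

Lemma porbit1 i : porbit (1%g : {perm 'I_n}) i = [set i].
Proof.
apply/setP => k; rewrite inE; apply/porbitP/eqP => [[m ->]|->].
  by rewrite expg1n perm1.
by exists 0; rewrite perm1.
Qed.

Lemma cfun1 i : cfun (orbit_cyc 1%g i) = 1%g.
Proof. by apply/permP => k; rewrite orbit_cycE !perm1 if_same. Qed.

End OrbitCycleExamples.

Section Final.

Variables (n : nat) (I : sf_instance n) (t : 'I_n -> nat).
Hypothesis final_t : final I t.
Implicit Types i j k : 'I_n.

Local Notation c := (cap I).

Let inv_t : inv I t. Proof. by case: final_t. Qed.
Let trimmed j : ~~ trim I t j. Proof. by case: final_t. Qed.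
Let short i : len I t i <= (c i).+1. Proof. by case: final_t. Qed.
Let le_t j : t j <= n.-1. Proof. by have [] := inv_t j. Qed.

Definition mutual i j : bool := out I t i j && out I t j i.
Definition active i : bool := c i < len I t i.

Lemma mutual_sym i j : mutual i j = mutual j i.
Proof. exact: andbC. Qed.

Lemma mutual_neq i j : mutual i j -> i != j.
Proof. by case/andP => /andP[/and3P[]]. Qed.

Lemma len_active i : active i -> len I t i = (c i).+1.
Proof. by move=> ai; apply/eqP; rewrite eqn_leq short. Qed.

Lemma worst_arc i : active i ->
  [/\ out I t (worst I t i) i, ~~ out I t i (worst I t i)
    & active (worst I t i)].
Proof.
move=> ai; split; [exact/worst_inn/ltnW | exact: worst_nout | exact:
  worst_active].
Qed.

(** Since [j] has only cap + 1 entries and does not propose to [i], it has [i] at position cap,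
    which is the last one. *)
Lemma arc_worst i j : out I t i j -> ~~ out I t j i ->
  [/\ active i, active j & worst I t j = i].
Proof.
move=> oij noji; have tji : tab I t j i by rewrite tab_sym; case/andP: oij.
have [aj ai] := tab_nout trimmed tji noji; split=> //.
have tw := worst_tab trimmed (ltnW aj).
apply: (pos_inj tw tji); apply/eqP; rewrite -eqSS pos_worst // len_active //.
rewrite eqSS eqn_leq leqNgt; move: noji; rewrite /out tji /= => -> /=.
by rewrite -ltnS -len_active ?pos_lt.
Qed.

Definition prev i : 'I_n := if active i then worst I t i else i.

(** No active agent proposes to its worst entry, and a final table allows each active agent only one
    entry that does not propose to it; so two active agents cannot share their worst entry. *)
Lemma prev_inj : injective prev.
Proof.
have act_eq i : active (prev i) = active i.
  by rewrite /prev; case: ifP => // /worst_arc[].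
move=> i j E; have := act_eq j; rewrite -E act_eq => Ea.
move: E; rewrite /prev -Ea; case: ifP => // ai E.
have aj : active j by rewrite -Ea.
have [oi ni aw] := worst_arc ai; have [oj nj _] := worst_arc aj.
apply: (nout_unique trimmed (len_active aw)) => //.
- by case/andP: oi.
- by rewrite E; case/andP: oj.
- by rewrite E.
Qed.

Definition succ : {perm 'I_n} := (perm prev_inj)^-1%g.

Lemma prev_succ i : prev (succ i) = i.
Proof. by rewrite -[LHS](permE prev_inj) permKV. Qed.

Lemma active_succ i : active (succ i) = active i.
Proof.
rewrite -[in RHS](prev_succ i) /prev; case: ifP => // a.
by have [_ _ ->] := worst_arc a.
Qed.

Lemma worst_succ i : active i -> worst I t (succ i) = i.
Proof. by move=> ai; rewrite -[RHS]prev_succ /prev active_succ ai. Qed.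

Lemma succ_worst i : active i -> succ (worst I t i) = i.
Proof.
move=> ai; apply: prev_inj; rewrite prev_succ /prev ai //.
Qed.

Lemma succ_arc i : active i -> out I t i (succ i) /\ ~~ out I t (succ i) i.
Proof.
move=> ai; have as_ : active (succ i) by rewrite active_succ.
by have [] := worst_arc as_; rewrite worst_succ.
Qed.

Lemma arc_succ i j : out I t i j -> ~~ out I t j i -> active i /\ succ i = j.
Proof.
move=> oij noji; have [ai aj w] := arc_worst oij noji.
by split=> //; rewrite -w succ_worst.
Qed.

Lemma succ_neq i : active i -> succ i != i.
Proof.
by move=> ai; rewrite eq_sym;
  case: (succ_arc ai) => /andP[/and3P[]].
Qed.

Lemma porbit_active i j : j \in porbit succ i -> active j = active i.
Proof.
case/porbitP => m ->; elim: m => [|m IHm]; first by rewrite perm1.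
by rewrite expgSr permM active_succ.
Qed.

(** The member of smallest index represents its cycle. Testing n iterates covers the whole orbit,
    and a loop of n iterations can do it. *)
Definition leader i : bool :=
  active i && [forall k : 'I_n, i <= iter k.+1 succ i].

Lemma leaderP i :
  reflect (active i /\ {in porbit succ i, forall j : 'I_n, i <= j})
  (leader i).
Proof.
apply: (iffP andP) => -[ai /= H]; split=> //; last first.
  by apply/forallP => k; apply: H; rewrite -iterS -permX mem_porbit.
move=> j; rewrite porbit_traject => /trajectP[[|m] lt_m ->] //.
have lt_mn : m < n.
  by apply: leq_trans (ltnW lt_m) _; rewrite -[X in _ <= X]card_ord max_card.
exact: (forallP H (Ordinal lt_mn)).
Qed.

Lemma leader_eq i j k : leader i -> leader j ->
  k \in porbit succ i -> k \in porbit succ j -> i = j.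
Proof.
move=> /leaderP[_ mi] /leaderP[_ mj];
  rewrite -!eq_porbit_mem => /eqP Ei /eqP Ej.
apply/val_inj/eqP; rewrite eqn_leq /= mi ?mj //.
  by rewrite -Ej Ei porbit_id.
by rewrite -Ei Ej porbit_id.
Qed.

Lemma leader_ex k : active k -> exists2 i, leader i & k \in porbit succ i.
Proof.
move=> ak; case: (arg_minnP (@nat_of_ord n) (porbit_id succ k)) => i ik min_i.
have Ei : porbit succ i = porbit succ k by apply/eqP; rewrite eq_porbit_mem.
exists i; last by rewrite Ei porbit_id.
apply/leaderP; split; first by rewrite (porbit_active ik).
by move=> j; rewrite Ei => /min_i.
Qed.

Definition fpair i j : bool := (i < j) && mutual i j.

(* [inl (i, j)] stands for the transposition (i j), [inr (false, i)] for the
   fixed point (i), and [inr (true, i)] for the cycle of [i] under [succ]. *)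
Definition item : Type := (('I_n * 'I_n) + (bool * 'I_n))%type.

Definition item_start (d : item) : 'I_n :=
  match d with inl (i, _) => i | inr (_, i) => i end.

Definition item_perm (d : item) : {perm 'I_n} :=
  match d with
  | inl (i, j) => tperm i j
  | inr (b, _) => if b then succ else 1%g
  end.

Definition item_cyc (d : item) : cyc_perm n :=
  orbit_cyc (item_perm d) (item_start d).

Definition pairs_of i : seq item :=
  [seq inl (i, j) | j <- enum 'I_n & fpair i j].
(** The truncated subtraction yields fixed points only for agents with fewer entries than their
    capacity. *)
Definition fixed_of i : seq item := nseq (c i - len I t i) (inr (false, i)).
Definition cycles_of i : seq item := nseq (leader i) (inr (true, i)).

Definition items : seq item :=
  flatten [seq pairs_of i | i <- enum 'I_n] ++
  flatten [seq fixed_of i | i <- enum 'I_n] ++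
  flatten [seq cycles_of i | i <- enum 'I_n].

Definition gsp : seq (cyc_perm n) := map item_cyc items.

Definition is_fixed (d : item) : bool :=
  if d is inr (false, _) then true else false.

Lemma mem_items d : (d \in items) =
  match d with
  | inl (i, j) => fpair i j
  | inr (b, i) => if b then leader i else len I t i < c i
  end.
Proof.
have Ep : (d \in flatten [seq pairs_of i | i <- enum 'I_n]) =
    (if d is inl (i, j) then fpair i j else false).
  apply/flatten_mapP/idP => [[i _ /mapP[j]]|].
    by rewrite mem_filter => /andP[fij _] ->.
  case: d => [[i j]|] // fij; exists i; first by rewrite mem_enum.
  by apply/mapP; exists j; rewrite // mem_filter fij mem_enum.
have Ef : (d \in flatten [seq fixed_of i | i <- enum 'I_n]) =
    (if d is inr (false, i) then len I t i < c i else false).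
  apply/flatten_mapP/idP => [[i _]|].
    by rewrite mem_nseq subn_gt0 => /andP[lt_c /eqP->].
  case: d {Ep} => [|[[] i]] // lt_c; exists i; first by rewrite mem_enum.
  by rewrite mem_nseq subn_gt0 lt_c eqxx.
have Ec : (d \in flatten [seq cycles_of i | i <- enum 'I_n]) =
    (if d is inr (true, i) then leader i else false).
  apply/flatten_mapP/idP => [[i _]|].
    by rewrite mem_nseq lt0b => /andP[li /eqP->].
  case: d {Ep Ef} => [|[[] i]] // li; exists i; first by rewrite mem_enum.
  by rewrite mem_nseq lt0b li eqxx.
by rewrite /items !mem_cat Ep Ef Ec; case: d {Ep Ef Ec} => [[i j]|[[] i]];
  rewrite ?orbF.
Qed.

Lemma items_pairwise : pairwise (fun d e =>
  is_fixed d && is_fixed e || (d != e)) items.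
Proof.
have upw (s : seq item) : uniq s -> pairwise (fun d e =>
  is_fixed d && is_fixed e || (d != e)) s.
  by rewrite uniq_pairwise; apply: sub_pairwise => d e /= ->; rewrite orbT.
rewrite /items !pairwise_cat; apply/and5P; split.
- apply/allrelP => d e /flatten_mapP[i _ /mapP[j _ ->]] /=.
  by rewrite mem_cat => /orP[]/flatten_mapP[k _];
    rewrite mem_nseq => /andP[_ /eqP->].
- apply/upw/allpairs_uniq_dep; first exact: enum_uniq.
    by move=> i _; apply/filter_uniq/enum_uniq.
  by move=> [i j] [i' j'] _ _ [-> ->].
- apply/allrelP => d e /flatten_mapP[i _]; rewrite mem_nseq => /andP[_ /eqP->].
  by move=> /flatten_mapP[k _]; rewrite mem_nseq => /andP[_ /eqP->].
- have fpw (s : seq item) : all is_fixed s ->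
      pairwise (fun d e => is_fixed d && is_fixed e || (d != e)) s.
    elim: s => //= d s IHs /andP[fd fs]; rewrite {}IHs // andbT.
    by apply: sub_all fs => e ->; rewrite fd.
  apply/fpw/allP => d /flatten_mapP[i _].
  by rewrite mem_nseq => /andP[_ /eqP->].
- apply/upw.
  have -> : flatten [seq cycles_of i | i <- enum 'I_n] =
      [seq inr (true, i) | i <- enum 'I_n & leader i].
    by elim: (enum 'I_n) => //= i s ->; rewrite /cycles_of; case: leader.
  by rewrite map_inj_uniq => [|i j [] //]; apply/filter_uniq/enum_uniq.
Qed.

Lemma item_cyc_set d i : (i \in cset (item_cyc d)) =
  match d with
  | inl (a, b) => (i == a) || (i == b)
  | inr (b, a) => if b then i \in porbit succ a else i == a
  end.
Proof.
by case: d => [[a b]|[[] a]] //=; rewrite ?porbit_tperm ?porbit1 !inE.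
Qed.

Lemma item_cycE d i : cfun (item_cyc d) i =
  match d with
  | inl (a, b) => tperm a b i
  | inr (b, a) => if b && (i \in porbit succ a) then succ i else i
  end.
Proof.
case: d => [[a b]|[[] a]].
- by have -> : cfun (item_cyc (inl (a, b))) = tperm a b by apply: cfun_tperm.
- exact: orbit_cycE.
- have -> : cfun (item_cyc (inr (false, a))) = 1%g by apply: cfun1.
  exact: perm1.
Qed.

(** * The defining conditions of a GSP *)

Lemma gsp_distinct_ok :
  pairwise (fun P Q => (fixed_point P && fixed_point Q) || cyc_distinct P Q)
    gsp.
Proof.
rewrite pairwise_map.
apply: (@sub_in_pairwise _ [in items] _ _ _ _ _ items_pairwise);
  last exact/allP.
pose differ d e := exists i, cfun (item_cyc d) i != cfun (item_cyc e) i.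
have differ_sym d e : differ d e -> differ e d.
  by case=> i; rewrite eq_sym; exists i.
have tc a b i : fpair a b -> leader i -> differ (inl (a, b)) (inr (true, i)).
  move=> /andP[_ mab] /leaderP[ai _]; exists i; rewrite !item_cycE porbit_id /=.
  have [oi noi] := succ_arc ai; have si := succ_neq ai.
  apply/eqP; case: tpermP => [Ei Es|Ei Es|_ _ Es].
  - by move: noi; rewrite -Es Ei; case/andP: mab => _ ->.
  - by move: noi; rewrite -Es Ei; case/andP: mab => ->.
  - by rewrite -Es eqxx in si.
have ft a b i : fpair a b -> differ (inl (a, b)) (inr (false, i)).
  move=> /andP[_ /mutual_neq ab]; exists a.
  by rewrite !item_cycE tpermL /= eq_sym.
have fc i j : leader i -> differ (inr (true, i)) (inr (false, j)).
  move=> /leaderP[ai _]; exists i.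
  by rewrite !item_cycE porbit_id /= succ_neq.
move=> d e; change (d \in items -> e \in items -> is_fixed d && is_fixed e ||
  (d != e) ->
  fixed_point (item_cyc d) && fixed_point (item_cyc e) ||
    cyc_distinct (item_cyc d) (item_cyc e)).
rewrite !mem_items => md me /orP[fx|neq]; apply/orP.
  left; case: d e md me fx => [[a b]|[[] i]] [[a' b']|[[] j]] //= _ _ _.
  by rewrite /fixed_point /= !porbit1 !cards1.
have [/andP[fd fe]|nfix] := boolP (is_fixed d && is_fixed e).
  left; case: d e md me fd fe {neq} => [[a b]|[[] i]] [[a' b']|[[] j]] //= _ _
    _ _.
  by rewrite /fixed_point /= !porbit1 !cards1.
right; suff [i di] : differ d e by apply/existsP; exists i.
case: d e md me neq nfix => [[a b]|[[] i]] [[a' b']|[[] j]] //= md me neq _.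
(* Two pairs are told apart at the smaller member [a] of the first, which is mapped to the larger
   [b]. If the second pair moves [a] downwards, the images lie on different sides of [a]. *)
- exists a; rewrite !item_cycE tpermL;
    move: md me => /andP[lt_ab _] /andP[lt_ab' _].
  case: tpermP neq => [->|Ea|_ _] neq.
  + by apply: contraNneq neq => ->.
  + by rewrite -val_eqE /= neq_ltn; move: lt_ab; rewrite Ea; lia.
  + by rewrite -val_eqE /= neq_ltn lt_ab orbT.
- exact: tc.
- exact: ft.
- exact/differ_sym/tc.
- exists i; rewrite !item_cycE porbit_id /= ifF; last first.
    apply: contraNF neq => ij; have := leader_eq md me (porbit_id _ _) ij.
    by move->.
  by move/leaderP: md => [/succ_neq].
- exact: fc.
- exact/differ_sym/ft.
- exact/differ_sym/fc.
Qed.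

Lemma cinv_item d j : d \in items -> j \in cset (item_cyc d) ->
  cinv (item_cyc d) j =
  match d with
  | inl (a, b) => tperm a b j
  | inr (b, _) => if b then worst I t j else j
  end.
Proof.
rewrite mem_items; case: d => [[a b]|[[] a]] md jP.
- rewrite -{1}(tpermK a b j); apply: (cinv_orbit_cyc (s := tperm a b)).
  by rewrite mem_porbit_perm.
- have aj : active j.
    by move: jP => /porbit_active->; case/leaderP: md.
  rewrite -{1}(succ_worst aj); apply: (cinv_orbit_cyc (s := succ)).
  by rewrite -mem_porbit_perm succ_worst.
- by rewrite -{1}[j](perm1 j); apply: (cinv_orbit_cyc (s := 1%g)).
Qed.

Lemma gsp_F1_ok :
  all (fun P => [forall j in cset P, wpref I j (cfun P j) (cinv P j)]) gsp.
Proof.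
rewrite all_map; apply/allP => d md /=; apply/forall_inP => j jP.
rewrite (cinv_item md jP) item_cycE; rewrite mem_items in md.
case: d md jP => [[a b]|[[] a]] md jP; rewrite /wpref ?eqxx //=.
have aj : active j by move: jP => /porbit_active->; case/leaderP: md.
have jC : j \in porbit succ a := jP.
(* On a long cycle the predecessor sits exactly at the threshold and the successor is an entry,
   hence at or above it. *)
rewrite jC pref_rk -(inj_eq (@rk_inj _ I j)) -leq_eqVlt rk_worst //.
by have [/andP[/and3P[]]] := succ_arc aj.
Qed.

(** For (F2) it is enough that preferring someone to a predecessor means ranking that agent strictly
    above the threshold. For a fixed point the threshold is still [n.-1], the rank of the agent
    itself. *)
Lemma cinv_item_rk d j : d \in items -> j \in cset (item_cyc d) ->
  rk I j (cinv (item_cyc d) j) <= t j.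
Proof.
move=> md jP; rewrite (cinv_item md jP); rewrite mem_items in md.
have mut_le a b : mutual a b -> rk I a b <= t a by case/andP => /andP[/and3P[]].
case: d md jP => [[a b]|[[] a]] md jP; last 1 first.
- rewrite rk_self (threshold_max inv_t trimmed) //.
  by move: jP; rewrite item_cyc_set => /eqP->.
- case/andP: md => _ mab; move: jP; rewrite item_cyc_set => /orP[]/eqP->.
    by rewrite tpermL; apply: mut_le.
  by rewrite tpermR; apply: mut_le; rewrite mutual_sym.
- by rewrite rk_worst.
Qed.

Lemma gsp_mutual i j : mutual i j -> has (is_transp i j) gsp.
Proof.
move=> mij; rewrite has_map; apply/hasP.
have [lt_ij|lt_ji|/val_inj Eij] := ltngtP i j.
- exists (inl (i, j)); first by rewrite mem_items /fpair lt_ij.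
  by rewrite /= /is_transp -porbit_tperm eqxx cfun_tperm eqxx.
- exists (inl (j, i)); first by rewrite mem_items /fpair lt_ji mutual_sym.
  by rewrite /= /is_transp setUC -porbit_tperm eqxx cfun_tperm tpermC eqxx.
- by move: (mutual_neq mij); rewrite Eij eqxx.
Qed.

Lemma gsp_F2_ok i j : i != j -> ~~ has (is_transp i j) gsp ->
  ~ (has (fun P => (i \in cset P) && pref I i j (cinv P i)) gsp /\
     has (fun Q => (j \in cset Q) && pref I j i (cinv Q j)) gsp).
Proof.
move=> neq_ij; apply: contraNnot => -[].
have below a b : has (fun P => (a \in cset P) && pref I a b (cinv P a)) gsp ->
    rk I a b < t a.
  rewrite has_map => /hasP[d md /= /andP[aP]]; rewrite pref_rk => lt_ab.
  exact: leq_trans lt_ab (cinv_item_rk md aP).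
move=> /below lt_i /below lt_j; apply: gsp_mutual.
(* With at most cap + 1 entries, an agent can fail to propose only to its last entry, which then
   sits at the threshold. A blocking pair would thus be mutual and hence already a transposition. *)
have out_below a b : tab I t a b -> rk I a b < t a -> out I t a b.
  move=> tab_ab lt_a; rewrite /out tab_ab /=.
  have [le_len|aa] := leqP (len I t a) (c a);
    first exact: leq_trans (pos_lt tab_ab) _.
  rewrite ltn_neqAle; have := pos_lt tab_ab; rewrite (len_active aa) ltnS => ->.
  rewrite andbT -eqSS -(len_active aa); have tw := worst_tab trimmed (ltnW aa).
  rewrite -(pos_worst (le_t a) tw) eqSS;
    apply: contraTneq lt_a => /(pos_inj tab_ab tw)->.
  by rewrite rk_worst ?ltnn.
have tij : tab I t i j by rewrite /tab neq_ij (ltnW lt_i) (ltnW lt_j).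
by rewrite /mutual !out_below // tab_sym.
Qed.

Lemma count_items (p : pred item) : count p items =
  \sum_i \sum_j (fpair i j && p (inl (i, j))) +
  \sum_i p (inr (false, i)) * (c i - len I t i) +
  \sum_i p (inr (true, i)) * leader i.
Proof.
have sum_of (f : 'I_n -> seq item) :
    count p (flatten [seq f i | i <- enum 'I_n]) = \sum_i count p (f i).
  by rewrite -big_enum; elim: (enum 'I_n) => [|i r IHr];
    rewrite ?big_nil // big_cons /= count_cat IHr.
rewrite /items !count_cat !sum_of addnA; congr (_ + _ + _).
- apply: eq_bigr => i _; rewrite count_map -big_enum.
  elim: (enum 'I_n) => [|j r IHr]; rewrite ?big_nil // big_cons /= -IHr.
  by case: fpair.
- by apply: eq_bigr => i _; rewrite count_nseq.
- by apply: eq_bigr => i _; rewrite count_nseq.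
Qed.

Lemma sum_leader k : \sum_i (k \in porbit succ i) * leader i = active k.
Proof.
have [ak|nak] := boolP (active k); last first.
  apply: big1 => i _; case: (boolP (k \in _)) => //= ki; rewrite mul1n.
  by apply/eqP; rewrite eqb0; apply: contra nak => /leaderP[ai _];
    rewrite (porbit_active ki).
have [i li ki] := leader_ex ak; rewrite (bigD1 i) //= li ki big1 // => j nji.
case: (boolP (k \in _)) => //= kj; rewrite mul1n; apply/eqP; rewrite eqb0.
by apply: contra nji => lj; rewrite (leader_eq lj li kj ki).
Qed.

(** Every proposal of [k] is reciprocated except the one to [succ k], which exists precisely when
    [k] is active. *)
Lemma sum_mutual k : \sum_j mutual k j + active k = minn (c k) (len I t k).
Proof.
rewrite -card_out -sum1dep_card [RHS]big_mkcond /=.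
have -> : active k = \sum_j (active k && (succ k == j)) :> nat.
  case: active; last by rewrite big1.
  by rewrite (bigD1 (succ k)) //= eqxx big1 // => j;
    rewrite eq_sym => /negbTE->.
rewrite -big_split; apply: eq_bigr => j _ /=; rewrite /mutual.
have [ok|nok] := boolP (out I t k j) => /=; last first.
  by apply/eqP; rewrite eqb0; apply: contra nok => /andP[/succ_arc[+ _] /eqP<-].
have [oj|noj] := boolP (out I t j k) => /=; last first.
  by have [-> ->] := arc_succ ok noj; rewrite eqxx.
have -> // : active k && (succ k == j) = false.
by apply: contraTF oj => /andP[/succ_arc[_ +] /eqP<-].
Qed.

Lemma sum_delta i (F : 'I_n -> nat) : \sum_a (i == a) * F a = F i.
Proof.
by rewrite (bigD1 i) //= eqxx mul1n big1 ?addn0 // => a;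
  rewrite eq_sym => /negbTE->.
Qed.

(* The two terms select from the pairs at [i] those that are listed with [i]
   first, respectively second. *)
Lemma sum_fpair i :
  \sum_a \sum_b ((i == a) * fpair a b + (i == b) * fpair a b) =
  \sum_j mutual i j.
Proof.
have sum_at := sum_delta i.
under eq_bigr => a _ do rewrite big_split /= -big_distrr sum_at /=.
rewrite big_split /= sum_at -big_split /=; apply: eq_bigr => j _.
rewrite /fpair (mutual_sym j); have [mij|] := boolP (mutual i j);
  last by rewrite !andbF.
have := mutual_neq mij; rewrite -val_eqE /= !andbT.
by case: ltngtP.
Qed.

Lemma gsp_F3_ok i : count (fun P => i \in cset P) gsp = c i.
Proof.
rewrite count_map (eq_count (fun d => item_cyc_set d i)) count_items /=.
rewrite sum_leader (bigD1 i (F := fun j => (i == j) * _)) //= eqxx mul1n.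
rewrite [X in _ + (_ + X)]big1 => [|j]; last by rewrite eq_sym => /negbTE->.
have -> : \sum_a \sum_b (fpair a b && ((i == a) || (i == b))) =
    \sum_j mutual i j.
  transitivity (\sum_a \sum_b ((i == a) * fpair a b + (i == b) * fpair a b)).
    apply: eq_bigr => a _; apply: eq_bigr => b _.
    have [fab|] := boolP (fpair a b); last by rewrite !muln0.
    rewrite !muln1 /=; case: (eqVneq i a) => [Ea|_];
      case: (eqVneq i b) => [Eb|_] //.
    by move: fab; rewrite /fpair -Ea -Eb ltnn.
  exact: sum_fpair.
have := sum_mutual i; have := @len_active i; rewrite /active.
by case: ltnP => [_ /(_ isT)->|le_c _]; lia.
Qed.

Lemma gsp_F4_ok i j : i != j ->
  count (fun P => cfun P i == j) gsp + count (fun P => cfun P j == i) gsp <= 2.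
Proof.
move=> neq_ij; pose arcs a b := count (fun P => cfun P a == b) gsp.
have arcsE a b : a != b -> arcs a b <= mutual a b + (active a && (succ a == b)).
  move=> nab; rewrite /arcs count_map (eq_count (a2 := fun d =>
    _ == b) (fun d => congr1 (eq_op^~ b) (item_cycE d a))).
  rewrite count_items /=.
  rewrite (negbTE nab) [X in _ + X + _]big1 // addn0; apply: leq_add;
    last first.
    have [->|nsab] := eqVneq (succ a) b.
      rewrite andbT -sum_leader; apply: leq_sum => i0 _; case: ifP => _.
        by rewrite eqxx.
      by rewrite (negbTE nab).
    by rewrite andbF big1 // => i0 _; case: ifP;
      rewrite ?(negbTE nsab) ?(negbTE nab).
  apply: (@leq_trans (\sum_x \sum_y ((a == x) * ((b == y) * fpair x y) +
                                      (b == x) * ((a == y) * fpair x y)))).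
    apply: leq_sum => x _; apply: leq_sum => y _.
    case: (fpair x y) => //=; rewrite !muln1; case: tpermP => [->|->|_ _].
    - by rewrite eqxx mul1n eq_sym leq_addr.
    - by rewrite eqxx muln1 eq_sym leq_addl.
    - by rewrite (negbTE nab).
  rewrite (eq_bigr (fun x => (a == x) * fpair x b + (b == x) * fpair x a)) =>
    [|x _].
    rewrite big_split /= !sum_delta /fpair (mutual_sym b).
    by case: (mutual a b); rewrite ?andbF // !andbT; case: ltngtP.
  by rewrite big_split /= -!big_distrr /= !sum_delta.
have := arcsE i j neq_ij; have := arcsE j i; rewrite eq_sym neq_ij => /(_ isT).
rewrite (mutual_sym j) /arcs; have [mij|_] := boolP (mutual i j); last first.
  by case: (_ && _); case: (_ && _) => /=; lia.
have /andP[oij oji] := mij.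
have -> : active i && (succ i == j) = false.
  by apply: contraTF oji => /andP[/succ_arc[_ +] /eqP<-].
have -> : active j && (succ j == i) = false.
  by apply: contraTF oij => /andP[/succ_arc[_ +] /eqP<-].
by lia.
Qed.

Lemma gsp_is_GSP : is_GSP I gsp.
Proof.
split; [exact: gsp_distinct_ok | exact: gsp_F1_ok | exact: gsp_F2_ok
       | exact: gsp_F3_ok | exact: gsp_F4_ok].
Qed.

Definition item_code (d : item) : seq nat :=
  match d with
  | inl (i, j) => [:: 2; val i; val j]
  | inr (b, i) =>
      if b then #|porbit succ i| :: map val (traject succ i #|porbit succ i|)
      else [:: 1; val i]
  end.

Lemma item_codeP d : d \in items -> cycle_code (item_cyc d) (item_start d) =
  item_code d.
Proof.
rewrite mem_items => md; rewrite /item_cyc orbit_cyc_code.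
case: d md => [[i j]|[[] i]] //= md; last by rewrite porbit1 cards1.
have nij : i != j by case/andP: md => _ /mutual_neq.
by rewrite porbit_tperm cards2 nij /= tpermL.
Qed.

Lemma gsp_codeP :
  gsp_code gsp (size items :: flatten [seq item_code d | d <- items]).
Proof.
exists (map item_start items); split.
  by rewrite /gsp; elim: items => //= d s ->; rewrite porbit_id.
rewrite size_map; congr (_ :: flatten _).
transitivity [seq cycle_code (item_cyc d) (item_start d) | d <- items].
  by apply/eq_in_map => d /item_codeP.
by rewrite /gsp; elim: items => //= d s ->.
Qed.

End Final.

(** * Writing the partition *)

Definition emit (e : expr) : prog :=
  PPut 2 (Reg 10) e ;; PSet 10 (Reg 10 + Cst 1).

Definition next_item : prog := PSet 11 (Reg 11 + Cst 1).

Definition pairs_prog : prog :=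
  PFor 3 (PFor 4
    (PIf ((Reg 3 < Reg 4) *
          (Get 5 (cell (Reg 3) (Reg 4)) * Get 5 (cell (Reg 4) (Reg 3))))
       (emit (Cst 2) ;; emit (Reg 3) ;; emit (Reg 4) ;; next_item) PSkip)).

Definition fixed_prog : prog :=
  PFor 3 (PFor 4
    (PIf (Reg 4 + Get 9 (Reg 3) < Get 0 (Reg 3))
       (emit (Cst 1) ;; emit (Reg 3) ;; next_item) PSkip)).

Definition succ_prog : prog :=
  PFor 3 (PIf (Get 0 (Reg 3) < Get 9 (Reg 3))
            (PPut 11 (Get 7 (cell (Reg 3) (Get 4 (Reg 3)))) (Reg 3)) PSkip).

(** Register 12 receives the length of the cycle as the time of the first return. The loop may go
    round several times, so the value is stored only while the register is still 0. *)
Definition leader_prog : prog :=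
  PSet 7 (Cst 1) ;; PSet 8 (Reg 3) ;; PSet 12 (Cst 0) ;;
  PFor 4
    (PSet 8 (Get 11 (Reg 8)) ;;
     PIf (Reg 8 < Reg 3) (PSet 7 (Cst 0)) PSkip ;;
     PIf ((Reg 8 == Reg 3) * (Reg 12 == Cst 0)) (PSet 12 (Reg 4 + Cst 1))
       PSkip).

Definition cycle_prog : prog :=
  emit (Reg 12) ;;
  PSet 8 (Reg 3) ;;
  PFor 4 (PIf (Reg 4 < Reg 12)
            (emit (Reg 8) ;; PSet 8 (Get 11 (Reg 8))) PSkip) ;;
  next_item.

Definition cycles_prog : prog :=
  PFor 3 (PIf (Get 0 (Reg 3) < Get 9 (Reg 3))
            (leader_prog ;; PIf (Reg 7) cycle_prog PSkip) PSkip).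

Definition output_prog : prog :=
  succ_prog ;; PSet 10 (Cst 1) ;; PSet 11 (Cst 0) ;;
  pairs_prog ;; fixed_prog ;; cycles_prog ;; PPut 2 (Cst 0) (Reg 11).

Lemma run_if e p q s :
  run (PIf e p q) s = if ev s e != 0 then run p s else run q s.
Proof. by []. Qed.

Lemma flatten_if (S T : Type) (a : pred S) (f : S -> T) (r : seq S) :
  flatten [seq if a x then [:: f x] else [::] | x <- r] =
  [seq f x | x <- r & a x].
Proof. by elim: r => //= x r ->; case: (a x). Qed.

Lemma flatten_nseq n m (T : Type) (x : T) : m <= n ->
  flatten [seq if k < m then [:: x] else [::] | k : 'I_n <- enum 'I_n] =
  nseq m x.
Proof.
move=> le_mn; rewrite (map_comp (fun k =>
  if k < m then _ else _) val) val_enum_ord.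
rewrite (flatten_if (fun k => k < m) (fun=> x)) -(subnKC le_mn) iotaD
  filter_cat.
rewrite (_ : filter _ (iota _ (n - m)) = [::]); last first.
  apply/eqP; rewrite -[_ == _]negbK -has_filter; apply/hasPn => k.
  by rewrite mem_iota -leqNgt => /andP[].
rewrite cats0 (_ : filter _ _ = iota 0 m); last first.
  by apply/all_filterP/allP => k; rewrite mem_iota.
by elim: m {le_mn} 0 => //= m IHm k; rewrite IHm.
Qed.

(** The shift by one reserves cell 0 for the number of cycles, which is known only at the end. *)
Definition output s (l : seq nat) : Prop :=
  reg s 10 = (size l).+1 /\ forall k, k < size l -> mem s 2 k.+1 = nth 0 l k.

Lemma emitP s l e : output s l -> output (run (emit e) s) (rcons l (ev s e)).
Proof.
move=> [s10 Hl]; split=> /= [|k];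
  rewrite size_rcons s10 ?addn1 // ltnS nth_rcons.
rewrite eqSS leq_eqVlt; case: eqVneq => [->|_ /= lt_k]; first by rewrite ltnn.
by rewrite lt_k Hl.
Qed.

Section Programs.

Variables (n : nat) (I : sf_instance n) (t : 'I_n -> nat).
Hypothesis final_t : final I t.
Implicit Types (i j k : 'I_n) (s : store).

Local Notation c := (cap I).
Local Notation item := (item n).
Local Notation succ := (succ final_t).
Local Notation item_code := (item_code final_t).

Definition written s (its : seq item) : Prop :=
  output s (flatten [seq item_code d | d <- its]) /\ reg s 11 = size its.

Lemma written_rcons s s' its d :
  output s' (flatten [seq item_code d | d <- its] ++ item_code d) ->
  reg s' 11 = (reg s 11).+1 -> written s its -> written s' (rcons its d).
Proof.
by move=> Ho H11 [_ s11]; split;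
  rewrite ?map_rcons ?flatten_rcons // size_rcons H11 s11.
Qed.

Lemma emit_for x p s (its : seq item) (f : 'I_n -> seq item) :
  reg s 0 = n -> x \notin [:: 0; 10; 11] -> 0 \notin wregs p ->
  written s its ->
  (forall i s' its', reg s' x = i ->
     (forall y, y \notin x :: wregs p -> reg s' y = reg s y) ->
     (forall b a, b \notin wbanks p -> mem s' b a = mem s b a) ->
     written s' its' -> written (run p s') (its' ++ f i)) ->
  written (run (PFor x p) s) (its ++ flatten [seq f i | i <- enum 'I_n]).
Proof.
move=> s0; rewrite !inE !negb_or => /and3P[x0 x10 x11] p0 Hs Hp.
pose P m s' := written s' (its ++ flatten [seq f i | i <- take m (enum 'I_n)]).
have : P n (run (PFor x p) s).
  apply: run_for => //.
  - move=> k s' v [[H10 Hm] H11]; split; [split=> //=|rewrite /=].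
      by rewrite (eq_sym 10) (negbTE x10).
    by rewrite (eq_sym 11) (negbTE x11).
  - by rewrite /P take0 cats0.
  - move=> i s' s'x Fr Fm IH;
      rewrite /P take_enum_ord map_rcons flatten_rcons catA.
    exact: Hp.
by rewrite /P take_enum_ord_all.
Qed.

Lemma pairs_progP s its : state I t s -> scanned I t s -> written s its ->
  written (run pairs_prog s)
    (its ++ flatten [seq pairs_of I t i | i <- enum 'I_n]).
Proof.
move=> [[s0 _ _ _] _] [Ho _ _ _] Hs;
  apply: emit_for => // i s1 its1 s13 Fr1 Fm1 H1.
rewrite /pairs_of -flatten_if; apply: emit_for => //; first by rewrite Fr1.
move=> j s2 its2 s24 Fr2 Fm2 H2.
set p := (emit _ ;; _); rewrite run_if [ev _ _]/=.
rewrite s24 !Fr2 // s13 Fr1 // s0 !Fm2 // !Fm1 // !Ho -lt0n !muln_gt0 !lt0b.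
rewrite -[(i < j) && _]/(fpair I t i j); case: ifP => _; last by rewrite cats0.
rewrite cats1; apply: written_rcons (H2); last by rewrite /= addn1.
case: H2 => [H2 _].
have s23 : reg s2 3 = i by rewrite Fr2.
have := emitP (Reg 4) (emitP (Reg 3) (emitP (Cst 2) H2)).
by rewrite /= s23 s24 -!cats1 -!catA.
Qed.

Lemma fixed_progP s its : state I t s -> scanned I t s -> written s its ->
  written (run fixed_prog s)
    (its ++ flatten [seq fixed_of I t i | i <- enum 'I_n]).
Proof.
move=> [[s0 Hc _ _] _] [_ _ _ Hlen] Hs.
apply: emit_for => // i s1 its1 s13 Fr1 Fm1 H1.
have le_n : c i - len I t i <= n by have := cap_bounds I i; lia.
rewrite /fixed_of -(flatten_nseq _ le_n); apply: emit_for => //;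
  first by rewrite Fr1.
move=> k s2 its2 s24 Fr2 Fm2 H2.
set p := (emit _ ;; _); rewrite run_if [ev _ _]/=.
rewrite s24 !Fr2 // s13 !Fm2 // !Fm1 // Hc Hlen -lt0n lt0b addnC ltn_subRL.
case: ifP => _; last by rewrite cats0.
rewrite cats1; apply: written_rcons (H2); last by rewrite /= addn1.
case: H2 => [H2 _].
have s23 : reg s2 3 = i by rewrite Fr2.
have := emitP (Reg 3) (emitP (Cst 1) H2).
by rewrite /= s23 -!cats1 -!catA.
Qed.

Lemma succ_progP s : state I t s -> scanned I t s ->
  forall i, active I t i -> mem (run succ_prog s) 11 i = succ i.
Proof.
move=> [[s0 Hc _ Hrow] Ht] [_ _ _ Hlen].
have le_t j : t j <= n.-1 by case: final_t => /(_ j)[].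
pose P m s' := forall i, i < m -> active I t i -> mem s' 11 (worst I t i) = i.
have H : P n (run succ_prog s).
  apply: run_for => // i s' s'3 Fr Fm IH j.
  rewrite ltnS leq_eqVlt val_eqE => lt_j aj.
  have lt_t : t i < n by move: (le_t i) (ltn_ord i); lia.
  rewrite /= s'3 Fr // s0 !Fm //= Hc Hlen Ht (Hrow i (Ordinal lt_t)) -lt0n lt0b.
  rewrite -/(active I t i) -/(worst I t i); case: ifP => [ai|nai] /=.
    rewrite val_eqE; case: eqVneq => [Ew|nw].
      (* Injectivity of [prev] ensures that no cell of the inverse is overwritten by another active
         agent. *)
      by apply/esym; congr val; apply: (prev_inj final_t); rewrite /prev ai aj.
    apply: IH => //; case/predU1P: lt_j nw => // ->; by rewrite eqxx.
  by apply: IH => //; case/predU1P: lt_j aj => // ->; rewrite nai.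
move=> i ai; rewrite -{1}(worst_succ final_t ai); apply: H => //.
by rewrite active_succ.
Qed.

Lemma leader_progP s i : active I t i -> reg s 0 = n -> reg s 3 = i ->
  (forall j, active I t j -> mem s 11 j = succ j) ->
  let s' := run leader_prog s in
  reg s' 7 = leader final_t i /\ reg s' 12 = #|porbit succ i|.
Proof.
move=> ai s0 s3 Hsucc s'; set o := #|porbit succ i|.
have o0 : 0 < o by rewrite lt0n; apply/eqP => /cards0_eq E;
  have := porbit_id succ i; rewrite E inE.
have le_on : o <= n by rewrite -[X in _ <= X]card_ord max_card.
pose x m : 'I_n := iter m succ i.
have ax m : active I t (x m) by elim: m => //= m; rewrite active_succ.
pose P m s := [/\ reg s 8 = x m,
  reg s 7 = [forall k : 'I_n, (k < m) ==> (i <= x k.+1)]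
  & reg s 12 = if o <= m then o else 0].
have [_ H7 H12] : P n s'.
  rewrite /s' /leader_prog run_seq run_seq run_seq; apply: run_for => //.
    split=> //=; last by rewrite leqNgt o0.
    by apply/esym/eqP; rewrite eqb1; apply/forallP.
  move=> k s1 s14 Fr Fm [IH8 IH7 IH12].
  have s13 : reg s1 3 = i by rewrite Fr.
  have s1n : mem s1 11 (x k) = x k.+1 by rewrite Fm //= Hsucc.
  have test : (x k.+1 == i :> nat) && (reg s1 12 == 0) = (k.+1 == o).
    rewrite IH12; have [le_ok|lt_ko] := leqP o k.
      by rewrite eqn0Ngt o0 andbF; apply/esym; lia.
    rewrite andbT; apply/eqP/eqP => [/val_inj Ex|->];
      last by rewrite /x iter_porbit.
    (* An earlier return would repeat [i] within a single passage through its orbit. *)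
    apply/eqP; rewrite eqn_leq lt_ko leqNgt; apply/negP => lt_k.
    have := uniq_traject_porbit succ i;
      rewrite -/o -[o]prednK //= => /andP[+ _].
    apply/negP/negPn/trajectP; exists (k : nat); first by lia.
    by rewrite -iterSr -[LHS]Ex.
  have allS : [forall k' : 'I_n, (k' < k.+1) ==> (i <= x k'.+1)] =
      [forall k' : 'I_n, (k' < k) ==> (i <= x k'.+1)] && ~~ (x k.+1 < i).
    rewrite -leqNgt; apply/forallP/andP => [H|[/forallP H le_i] k'].
      split; last by have := H k; rewrite ltnSn.
      by apply/forallP => k'; apply/implyP => lt_k; have := H k';
        rewrite (leqW lt_k).
    apply/implyP; rewrite ltnS leq_eqVlt val_eqE => /predU1P[->//|lt_k].
    by have := H k'; rewrite lt_k.
  have o_step : (if o <= k.+1 then o else 0) =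
      if k.+1 == o then k.+1 else reg s1 12.
    by rewrite IH12 leq_eqVlt eq_sym ltnS; case: eqVneq => [->|].
  have lt_test : ((x k.+1 < i : nat) != 0) = (x k.+1 < i) by rewrite -lt0n lt0b.
  have eq_test : ((x k.+1 == i :> nat) * (reg s1 12 == 0) != 0) = (k.+1 == o).
    by rewrite -test -lt0n muln_gt0 !lt0b.
  rewrite !run_seq !run_if /= IH8 s1n s13 lt_test.
  case lt_xi: (x k.+1 < i) => /=; rewrite ?s13 eq_test;
    case ko: (k.+1 == o); rewrite ko in o_step;
    by split; rewrite /= ?allS ?o_step ?lt_xi ?IH7 ?andbT ?andbF ?s14 ?addn1.
rewrite H7 H12 le_on; split=> //; rewrite /leader ai /=.
by congr (nat_of_bool _); apply: eq_forallb => k; rewrite ltn_ord.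
Qed.

Lemma cycle_progP s i its : active I t i -> leader final_t i -> reg s 0 = n ->
  reg s 3 = i -> reg s 12 = #|porbit succ i| ->
  (forall j, active I t j -> mem s 11 j = succ j) ->
  written s its -> written (run cycle_prog s) (rcons its (inr (true, i))).
Proof.
move=> ai li s0 s3 s12 Hsucc Hs; set o := #|porbit succ i| in s12.
have le_on : o <= n by rewrite -[X in _ <= X]card_ord max_card.
pose x m : 'I_n := iter m succ i.
have ax m : active I t (x m) by elim: m => //= m; rewrite active_succ.
rewrite /cycle_prog run_seq run_seq run_seq.
have := emitP (Reg 12) Hs.1; set s1 := run (emit _) s => Ho1.
set s2 := run (PSet 8 _) s1; set p := PIf _ _ _.
pose l := flatten [seq item_code d | d <- its].
(* The minimum expresses that the loop is idle once the whole cycle has been written. *)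
pose P m s := reg s 8 = x (minn m o) /\
  output s (rcons l o ++ map val (traject succ i (minn m o))).
have [_ Ho] : P n (run (PFor 4 p) s2).
  apply: run_for => //.
    by split; rewrite min0n //= cats0 -s12.
  move=> k s' s'4 Fr Fm [IH8 IHo];
    rewrite /p run_if /= s'4 Fr //= s12 -lt0n lt0b.
  case: ltnP => [lt_ko|le_ok];
    last by rewrite /P !(minn_idPr _) ?(leqW le_ok) // in IH8 IHo *.
  rewrite (minn_idPl (ltnW lt_ko)) in IH8 IHo.
  have := emitP (Reg 8) IHo; rewrite /P (minn_idPl lt_ko) trajectSr map_rcons
    -rcons_cat /= IH8.
  by split=> //=; rewrite Fm //= Hsucc.
move: Ho; rewrite (minn_idPr le_on).
move: (run (PFor 4 p) s2) (@run_reg (PFor 4 p) s2) => s5 Fr5 Ho.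
apply: written_rcons Hs; last by rewrite /= addn1 Fr5.
by move: Ho; rewrite -/l -cats1 -catA.
Qed.

Lemma cycles_progP s its : state I t s -> scanned I t s ->
  (forall j, active I t j -> mem s 11 j = succ j) -> written s its ->
  written (run cycles_prog s)
    (its ++ flatten [seq cycles_of final_t i | i <- enum 'I_n]).
Proof.
move=> [[s0 Hc _ _] _] [_ _ _ Hlen] Hsucc Hs.
apply: emit_for => // i s1 its1 s13 Fr Fm H1.
rewrite run_if [ev _ _]/= s13 !Fm // Hc Hlen -lt0n lt0b -/(active I t i)
  /cycles_of.
case: ifP => ai; last by rewrite /leader ai cats0.
have Hsucc1 j : active I t j -> mem s1 11 j = succ j by rewrite Fm //;
  apply: Hsucc.
have s10 : reg s1 0 = n by rewrite Fr.
have [H7 H12] := leader_progP ai s10 s13 Hsucc1.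
have H2 : written (run leader_prog s1) its1.
  case: H1 => [[H10 Hm] H11].
  by split; [split=> [|k lt_k] | ]; rewrite ?run_reg ?run_mem //; apply: Hm.
rewrite run_seq run_if -[ev _ _]/(reg (run leader_prog s1) 7) H7 -lt0n lt0b.
case: ifP => li; last by rewrite cats0.
rewrite cats1; apply: cycle_progP => // [||j aj]; rewrite ?run_reg ?run_mem //.
exact: Hsucc1.
Qed.

Lemma output_progP s : state I t s -> scanned I t s ->
  outputs_GSP I (run output_prog s).
Proof.
move=> Hs Hscan; exists (gsp final_t).
exists (size (items final_t) :: flatten [seq item_code d | d <- items final_t]).
split; [exact: gsp_is_GSP | exact: gsp_codeP |].
have pres p s' : all [predC wregs p] [:: 0] ->
    all [predC wbanks p] [:: 0; 3; 4; 5; 6; 7; 8; 9] ->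
    state I t s' /\ scanned I t s' -> state I t (run p s') /\ scanned I t (run
      p s').
  move=> p0 /= /and5P[b0 b3 b4 b5 /and5P[b6 b7 b8 b9 _]] [Hs' [Ho Hi Hsec Hl]].
  split; first by apply: state_run => //=; rewrite b0 b3 b4 b7.
  by split=> *; rewrite run_mem //; auto.
rewrite /output_prog 6!run_seq.
have Hsucc := succ_progP Hs Hscan.
have := pres succ_prog s isT isT (conj Hs Hscan).
move: (run succ_prog s) Hsucc => {Hs Hscan} s1 Hsucc HS1.
have HS2 := pres (PSet 11 (Cst 0)) _ isT isT (pres (PSet 10 (Cst 1)) _ isT isT
  HS1).
have Hw : written (run (PSet 11 (Cst 0)) (run (PSet 10 (Cst 1)) s1)) [::] by [].
have {}Hsucc j : active I t j ->
  mem (run (PSet 11 (Cst 0)) (run (PSet 10 (Cst 1)) s1)) 11 j = succ j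
  := Hsucc j.
move: (run _ (run _ s1)) HS2 Hw Hsucc => s2 HS2 Hw Hsucc.
have HS3 := pres pairs_prog _ isT isT HS2.
have Hw3 := pairs_progP HS2.1 HS2.2 Hw.
have HS4 := pres fixed_prog _ isT isT HS3.
have Hw4 := fixed_progP HS3.1 HS3.2 Hw3.
have Hsucc4 j : active I t j -> mem (run fixed_prog (run pairs_prog s2)) 11 j =
  succ j.
  by move=> aj; rewrite !run_mem //; apply: Hsucc.
have := cycles_progP HS4.1 HS4.2 Hsucc4 Hw4;
  rewrite cat0s -catA -/(items final_t).
move: (run cycles_prog _) => s5 [[_ Hm] H11].
apply: (@eq_from_nth _ 0); rewrite size_mkseq // => k lt_k.
rewrite nth_mkseq //=; case: k lt_k => [|k] /=; first by rewrite H11.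
by rewrite ltnS => /Hm.
Qed.

End Programs.

(** * The complete program, its running time and its word length *)

Definition gsp_prog : prog :=
  init_prog ;; main_loop ;; scan_prog ;; output_prog.

Lemma gsp_progP n (I : sf_instance n) :
  outputs_GSP I (run gsp_prog (input_store I)).
Proof.
rewrite /gsp_prog 3!run_seq.
have [Hload Htau] := init_progP I.
have [t Ht final_t] := main_loopP (conj Hload Htau : state I (fun=> n.-1) _).
apply: (output_progP final_t); first exact: state_run.
by apply: scan_progP => // j; case: final_t => /(_ j)[].
Qed.

Lemma input_bounded n (I : sf_instance n) : bounded n (input_store I).
Proof.
split=> [x|b k] /=; first by case: ifP.
have nth_le (r : seq nat) : all (fun v => v <= n) r -> nth 0 r k <= n.
  move=> /all_nthP H; have [lt_k|le_k] := ltnP k (size r); first exact: H.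
  by rewrite nth_default.
case: ifP => _; first apply: nth_le.
  by rewrite all_map; apply/allP => i _ /=;
    have /andP[_ /ltnW] := cap_bounds I i.
case: ifP => // _; apply/nth_le/allP => v /flatten_mapP[i _ /mapP[j _ ->]].
by apply: ltnW.
Qed.

Theorem theorem7 :
  exists (prog : cmd) (T wlen : nat -> nat),
    [/\ bigO T (fun n => n ^ 4),
        bigO wlen (fun n => up_log 2 n) &
        forall (n : nat) (I : sf_instance n),
          exists (t : nat) (s : store),
            [/\ exec (wlen n) prog (input_store I) t s,
                t <= T n &
                outputs_GSP I s]].
Proof.
pose V n := pmax gsp_prog (n + growth gsp_prog n).
exists (compile gsp_prog), (cost gsp_prog), (fun n => up_log 2 (V n).+1); split.
(* The exponent 4 is the nesting depth: two loops for the rounds around the two that scan the table.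
   The factor [2 ^ 4] replaces n + 1 by n, as n + 1 is at most 2n for positive n. *)
- have [K costK] := cost_depth gsp_prog; exists (K * 2 ^ 4), 1 => n n0.
  have E : depth gsp_prog = 4 by [].
  apply: leq_trans (costK n) _; rewrite E -mulnA -expnMn leq_mul2l leq_exp2r //.
  by apply/orP; right; lia.
- apply/bigO_up_log/poly_bounded_pmax/poly_bounded_add;
    first exact: poly_bounded_id.
  exact: poly_bounded_growth.
move=> n I; have ltV : V n < 2 ^ up_log 2 (V n).+1 by apply: up_logP.
have [|_ [t ex let_]] := @exec_compile _ n gsp_prog _ _ isT _ isT
  (input_bounded I) ltV.
  by [].
exists t, (run gsp_prog (input_store I)); split=> //; exact: gsp_progP.
Qed.
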